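(* (Block complex step approximation, second order partial derivative.) Let $A(x)$ be a complex $n\times n$ matrix depending on $x=(x_1,\dots,x_j)\in\mathbb{R}^j$, twice differentiable at $\bar{x}$, and let $f$ be analytic on an open set $\Omega\subseteq\mathbb{C}$ containing the spectrum of $A(\bar{x})$ and such that $f(B)$ is real-valued for real matrices $B$. Let $\alpha=\beta+\gamma$ be a multi-index with $|\beta|=|\gamma|=1$, and write $A=A(\bar{x})$ and $A^{(\delta)}=\partial^\delta A(x)|_{x=\bar{x}}$ for $\delta\in\{\alpha,\beta,\gamma\}$. For real $h\neq 0$ let $$X=\begin{bmatrix}A & hA^{(\beta)} & hA^{(\gamma)} & h^2A^{(\alpha)}\\ -hA^{(\beta)} & A & -h^2A^{(\alpha)} & hA^{(\gamma)}\\ -hA^{(\gamma)} & -h^2A^{(\alpha)} & A & hA^{(\beta)}\\ h^2A^{(\alpha)} & -hA^{(\gamma)} & -hA^{(\beta)} & A\end{bmatrix}.$$ Then, as $h\to 0$, $$\partial^\alpha f(A(x))|_{x=\bar{x}}=\frac{1}{h^2}\,[f(X)]_{1,4}+O(h^2),$$ where $[\cdot]_{1,4}$ denotes the upper right $n\times n$ block.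
   Context: $f(B)$ denotes the matrix function in the standard sense (for square matrices of any size with spectrum in $\Omega$). ''Real-valued for real matrices'' means: $f(B)$ is real for every real square matrix $B$ with spectrum in $\Omega$. *)

(* Defs.v *)
From HB Require Import structures.
From mathcomp Require Import all_boot all_order all_algebra.
From mathcomp Require Import complex.
From mathcomp Require Import all_classical all_reals all_analysis.

Set Implicit Arguments.
Unset Strict Implicit.
Unset Printing Implicit Defensive.

Import Order.TTheory GRing.Theory Num.Theory.
Import numFieldNormedType.Exports.

Local Open Scope classical_set_scope.
Local Open Scope ring_scope.

(* The topology on R[i] is that of the modulus, as for any numFieldType. *)
Section ComplexTopology.
Variable R : realType.
#[non_forgetful_inheritance]
HB.instance Definition _ := GRing.ComAlgebra.copy R[i] R[i]^o.
#[non_forgetful_inheritance]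
HB.instance Definition _ := Vector.copy R[i] R[i]^o.
#[non_forgetful_inheritance]
HB.instance Definition _ := NormedModule.copy R[i] R[i]^o.
End ComplexTopology.

Section MatrixFunction.
Variable R : realType.
Local Notation C := R[i].
Implicit Types (f : C -> C) (D : set C).

Definition analytic_on f D :=
  forall z0, D z0 -> exists a : nat -> C, \forall z \near z0,
    series (fun k => a k * (z - z0) ^+ k) @ \oo --> f z.

Definition spectrum n (B : 'M[C]_n) : set C := [set l | eigenvalue B l].

(* [derive1n k f l] is the k-th complex derivative of [f] at [l]. The
   multiplicity of an eigenvalue [l] in the minimal polynomial of [B] is its
   index, i.e. the size of the largest Jordan block of [B] at [l]. *)
Definition hermite_interpolant f n (B : 'M[C]_n.+1) (p : {poly C}) :=
  forall l, spectrum B l -> forall k, (k < mup l (mxminpoly B))%N ->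
    (derivn k p).[l] = derive1n k f l.

(* f(B) = p(B) for any p interpolating f on the spectrum of B; p(B) does not
   depend on the interpolant, since any two of them agree modulo the minimal
   polynomial of B. *)
Definition matfun f n (B : 'M[C]_n.+1) : 'M[C]_n.+1 :=
  horner_mx B (xget 0 [set p | hermite_interpolant f B p]).

Definition real_on_real_matrices f D :=
  forall n (B : 'M[C]_n.+1), B \is a mxOver Num.real -> spectrum B `<=` D ->
    matfun f B \is a mxOver Num.real.

End MatrixFunction.

Section PartialDerivatives.
Variables (R : realType) (j m n : nat).
Local Notation C := R[i].
Implicit Types (F : 'rV[R]_j -> 'M[C]_(m, n)) (x : 'rV[R]_j).

(* Derivatives in the real variable x of a complex matrix are taken on its
   real and imaginary parts. *)
Definition ReM F : 'rV[R]_j -> 'M[R]_(m, n) := fun x => map_mx (@complex.Re R) (F x).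
Definition ImM F : 'rV[R]_j -> 'M[R]_(m, n) := fun x => map_mx (@complex.Im R) (F x).

(* Twice Frechet differentiable at x: differentiable near x, with a
   differential that is itself differentiable at x. *)
Definition twice_differentiable_real (G : 'rV[R]_j -> 'M[R]_(m, n)) x :=
  (\forall y \near x, differentiable G y) /\
  forall v, differentiable (fun y => 'd G y v) x.

Definition twice_differentiable F x :=
  twice_differentiable_real (ReM F) x /\ twice_differentiable_real (ImM F) x.

Definition pderiv1 (i : 'I_j) F : 'rV[R]_j -> 'M[C]_(m, n) := fun x =>
  map2_mx (fun a b => a +i* b)%C
    ('D_(delta_mx 0 i) (ReM F) x) ('D_(delta_mx 0 i) (ImM F) x).

Definition pderivable1 (i : 'I_j) F x :=
  derivable (ReM F) x (delta_mx 0 i) /\ derivable (ImM F) x (delta_mx 0 i).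

Definition pderiv_seq (s : seq 'I_j) F := foldr pderiv1 F s.

Fixpoint pderivable_seq (s : seq 'I_j) F x : Prop :=
  if s is i :: s' then
    (\forall y \near x, pderivable_seq s' F y) /\
    pderivable1 i (pderiv_seq s' F) x
  else True.

Definition multiindex := {ffun 'I_j -> nat}.

Definition multiindex_seq (d : multiindex) : seq 'I_j :=
  flatten [seq nseq (d i) i | i <- enum 'I_j].

(* [pderiv] is a total operator: [pderivable d F x] says that the derivative
   [pderiv d F x] exists. *)
Definition pderiv (d : multiindex) F := pderiv_seq (multiindex_seq d) F.
Definition pderivable (d : multiindex) F x :=
  pderivable_seq (multiindex_seq d) F x.

End PartialDerivatives.

Definition multiindex_order j (d : multiindex j) : nat := (\sum_i d i)%N.

Section BlockMatrix.
Variables (R : realType) (n : nat).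
Local Notation C := R[i].

(* [quad_pred n].+1 is convertible to (n.+1 + n.+1) + (n.+1 + n.+1); the
   successor form is the one on which matrix functions are defined. *)
Definition quad_pred : nat := (n + n.+1 + (n.+1 + n.+1))%N.

Definition block_complex_step (A Ab Ag Aa : 'M[C]_n.+1) (h : C) :
    'M[C]_quad_pred.+1 :=
  block_mx
    (block_mx A             (h *: Ab)
              (- (h *: Ab)) A)
    (block_mx (h *: Ag)            (h ^+ 2 *: Aa)
              (- (h ^+ 2 *: Aa))   (h *: Ag))
    (block_mx (- (h *: Ag))        (- (h ^+ 2 *: Aa))
              (h ^+ 2 *: Aa)       (- (h *: Ag)))
    (block_mx A             (h *: Ab)
              (- (h *: Ab)) A).

Definition block14 (M : 'M[C]_quad_pred.+1) : 'M[C]_n.+1 :=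
  ursubmx (ursubmx (M : 'M[C]_((n.+1 + n.+1) + (n.+1 + n.+1)))).

End BlockMatrix.

(* Main.v *)
(* Let q be the square of the characteristic polynomial of A = A(xbar). Newton
   interpolation of f at the roots of q^4 gives one polynomial p such that, for
   matrices M of every size, f(M) - p(M) = q(M)^4 g(M), where g(M) stays bounded
   as long as M is bounded and q(M) is small: interpolate once more, at the
   eigenvalues of M, with coefficients controlled by weighted bounds on the
   power series of f around the roots of q. Hence f(M) = p(M) + O(t^4) along
   every Lipschitz curve of matrices that starts at a root of q.

   Applied to X(h), this reduces [f(X(h))]_{1,4} to [p(X(h))]_{1,4}, which is
   computed in the commutative algebra generated by two square roots of -1: its
   value is h^2 D + O(h^4), with D the second order term of p at A in the
   directions A^(beta), A^(gamma), A^(alpha). Applied to the curve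
   [[A, E], [0, A]], whose (1,2) block under f is the derivative of f at A in the
   direction E, it shows that the second derivative of f(A(x)) is D as well. *)
Require Import Defs.
From HB Require Import structures.
From mathcomp Require Import all_boot all_order all_algebra.
From mathcomp Require Import complex.
From mathcomp Require Import all_classical all_reals all_analysis.
From mathcomp Require Import ring lra.

Set Implicit Arguments.
Unset Strict Implicit.
Unset Printing Implicit Defensive.

Import Order.TTheory GRing.Theory Num.Theory.
Import numFieldNormedType.Exports.

Local Open Scope classical_set_scope.
Local Open Scope ring_scope.

(** * Complex modulus and geometric series *)

(** The obstacle is uniformity in the matrix. As a curve of matrices approaches its starting point,
    eigenvalues may merge or split in any way, so the nodes and the multiplicities that define
    [matfun] jump, and interpolation formulas with node differences in the denominator blow up.
    Divided differences do not: replacing [F] by [(F z - F mu) / (z - mu)] keeps the radius of the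
    expansions and multiplies their constant by [2 * rho], wherever [mu] lies in the discs around
    the roots of [q]. The number of divisions depends only on the matrix size, hence so do the
    bounds. Since the eigenvalues of the starting point may be far apart, [f] is handled as a family
    of expansions in disjoint discs, one per root. The fact that [p] does not depend on the matrix
    size is essential: it is evaluated at [A], at block matrices of twice that size for the
    derivatives of [f(A(x))], and at [X(h)] of four times that size, so that both sides of the
    formula meet in one expression. *)

Local Notation normc := Normc.normc.

Section ComplexModulus.
Variable R : realType.
Implicit Types (x y z : R[i]) (a c r e : R).

Lemma normr_normc x : `|x| = (normc x)%:C%C.
Proof. by case: x. Qed.

Lemma normc_ge0 x : 0 <= normc x.
Proof. by case: x => a b; apply: sqrtr_ge0. Qed.

Lemma ler_normcD x y : normc (x + y) <= normc x + normc y.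
Proof. exact: le_normcD. Qed.

Lemma normc_opp x : normc (- x) = normc x.
Proof. exact: normcN. Qed.

Lemma ler_normcB x y : normc (x - y) <= normc x + normc y.
Proof. by rewrite -(normc_opp y) ler_normcD. Qed.

Lemma normc_distC x y : normc (x - y) = normc (y - x).
Proof. by rewrite -normc_opp opprB. Qed.

Lemma ler_normc_distD z x y : normc (x - y) <= normc (x - z) + normc (z - y).
Proof. by rewrite -[x - y](subrKA z) ler_normcD. Qed.

Lemma normc_eq0 x : (normc x == 0) = (x == 0).
Proof.
by apply/eqP/eqP => [/Normc.eq0_normc //|->]; rewrite Normc.normc0.
Qed.

Lemma normcX x n : normc (x ^+ n) = normc x ^+ n.
Proof.
elim: n => [|n IHn]; first by rewrite !expr0 Normc.normc1.
by rewrite !exprS Normc.normcM IHn.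
Qed.

Lemma normcR a : normc a%:C%C = `|a|.
Proof. by rewrite /= expr0n /= addr0 sqrtr_sqr. Qed.

Lemma normc_nat n : normc n%:R = n%:R :> R.
Proof.
have -> : n%:R = (n%:R : R)%:C%C :> R[i] by rewrite rmorph_nat.
by rewrite normcR normr_nat.
Qed.

Lemma ler_normc_sum I (s : seq I) (P : pred I) (F : I -> R[i]) :
  normc (\sum_(i <- s | P i) F i) <= \sum_(i <- s | P i) normc (F i).
Proof.
elim/big_rec2: _ => [|i y1 y2 _ h]; first by rewrite Normc.normc0.
by apply: le_trans (ler_normcD _ _) _; rewrite lerD2l.
Qed.

Lemma ler_normc_ReIm x : normc x <= `|complex.Re x| + `|complex.Im x|.
Proof.
rewrite [leLHS](_ : _ = normc ((complex.Re x)%:C%C + 'i%C * (complex.Im x)%:C%C));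
  last by congr normc; case: x => a b; simpc.
apply: le_trans (ler_normcD _ _) _.
rewrite Normc.normcM !normcR.
have -> : normc ('i%C : R[i]) = 1 by rewrite /= expr0n /= add0r expr1n sqrtr1.
by rewrite mul1r.
Qed.

Lemma ger_normc_Re x : `|complex.Re x| <= normc x.
Proof. by rewrite -lecR -normr_normc normc_ge_Re. Qed.

Lemma ger_normc_Im x : `|complex.Im x| <= normc x.
Proof.
case: x => a b /=; rewrite -sqrtr_sqr; apply: ler_wsqrtr.
by rewrite lerDr sqr_ge0.
Qed.

Lemma nbhs_normcP z0 (P : R[i] -> Prop) :
  (\forall z \near z0, P z) <->
  exists2 d : R, 0 < d & forall z, normc (z - z0) < d -> P z.
Proof.
split=> [/nbhs_ballP[e /= e0 H]|[d d0 H]].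
  (* A positive element of [R[i]] is a real number. *)
  have [/eqP e1 e2] : complex.Im e == 0 /\ 0 < complex.Re e.
    by move: e0; rewrite ltcE /= => /andP[].
  exists (complex.Re e) => // z Hz; apply: H; rewrite -ball_normE /=.
  rewrite distrC normr_normc.
  by rewrite ltcE /= e1 eqxx Hz.
apply/nbhs_ballP; exists d%:C%C; first by rewrite /= ltcR.
by move=> z; rewrite -ball_normE /= distrC normr_normc ltcR => /H.
Qed.

(** As [n <= 2 ^ n], the hypothesis bounds [a * n] by [c] for all [n]. Truncated series are compared
    through this bound, with a truncation order left arbitrary. *)
Lemma ler0_half_expn a c : (forall n, a <= c * 2^-1 ^+ n) -> a <= 0.
Proof.
move=> H; rewrite leNgt; apply/negP => a0.
have K n : a * n%:R <= c.
  apply: le_trans (_ : a * 2 ^+ n <= c).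
    rewrite ler_pM2l // -natrX ler_nat; exact: ltnW (ltn_expl _ _).
  by have := H n; rewrite exprVn ler_pdivlMr // exprn_gt0.
have := K (Num.bound (c / a)); rewrite mulrC -ler_pdivlMr // leNgt.
have c0 : 0 <= c by have := K 0%N; rewrite mulr0.
by rewrite archi_boundP // divr_ge0 // ltW.
Qed.

Lemma normc_half_expn_eq0 x c : (forall n, normc x <= c * 2^-1 ^+ n) -> x = 0.
Proof.
move=> /ler0_half_expn x0; apply/eqP.
by rewrite -normc_eq0 eq_le x0 normc_ge0.
Qed.

End ComplexModulus.

Section GeometricSeries.
Variable R : realType.
Implicit Types (b : nat -> R[i]) (c t e : R).

Lemma ge0_of_geometric b c t : (forall k, normc (b k) <= c * t ^+ k) -> 0 <= c.
Proof. by move=> /(_ 0%N); rewrite mulr1; apply: le_trans; apply: normc_ge0. Qed.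

Lemma geometric_sum_le c t m n : 0 <= c -> 0 <= t <= 2^-1 -> (n <= m)%N ->
  \sum_(n <= k < m) c * t ^+ k <= 2 * c * t ^+ n.
Proof.
move=> c0 /andP[t0 t1] /subnKC <-; move: (m - n)%N => d; elim: d => [|d IH] in n *.
  by rewrite addn0 big_geq // !mulr_ge0 ?exprn_ge0.
rewrite addnS big_ltn ?ltnS ?leq_addr // -addSn.
have := IH n.+1; rewrite exprS.
have ctn : 0 <= c * t ^+ n by rewrite mulr_ge0 ?exprn_ge0.
have : 0 <= (2^-1 - t) * (c * t ^+ n) by rewrite mulr_ge0 // subr_ge0.
set S := \sum_(_ <= _ < _) _; move: ctn; set p := t ^+ n; lra.
Qed.

Lemma real_geometric_cvg (b : nat -> R) c t : 0 <= t <= 2^-1 ->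
  (forall k, `|b k| <= c * t ^+ k) ->
  exists s : R, forall e : R, 0 < e -> exists N, forall n, (N <= n)%N ->
    `|s - \sum_(k < n) b k| < e.
Proof.
move=> /andP[t0 t1] bc.
have cv : cvgn (series b).
  apply: normed_cvg; apply: (@series_le_cvg _ _ (geometric c t)) => //.
  - by move=> n; apply: normr_ge0.
  - by move=> n; rewrite /geometric /=; apply: le_trans (bc n).
  - by apply: is_cvg_geometric_series; rewrite ger0_norm //; lra.
exists (limn (series b)) => e e0.
have /cvgrPdist_lt /(_ e e0) [N _ HN] := cv.
by exists N => n /HN; rewrite /series /= big_mkord.
Qed.

(** Completeness is used on real and imaginary parts separately; the factor 2 is the sum of the
    powers of 1/2, the largest ratio allowed. *)
Lemma geometric_cvg b c t : 0 <= t <= 2^-1 ->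
  (forall k, normc (b k) <= c * t ^+ k) ->
  exists s, forall n, normc (s - \sum_(k < n) b k) <= 2 * c * t ^+ n.
Proof.
move=> t01 bc; have c0 := ge0_of_geometric bc.
have [|s1 H1] := @real_geometric_cvg (fun k => complex.Re (b k)) c t t01.
  by move=> k; apply: le_trans (bc k); apply: ger_normc_Re.
have [|s2 H2] := @real_geometric_cvg (fun k => complex.Im (b k)) c t t01.
  by move=> k; apply: le_trans (bc k); apply: ger_normc_Im.
have ReS m : complex.Re (\sum_(k < m) b k) = \sum_(k < m) complex.Re (b k).
  by elim/big_rec2: _ => // i x y _ <-; case: (b i) => ? ?; case: y.
have ImS m : complex.Im (\sum_(k < m) b k) = \sum_(k < m) complex.Im (b k).
  by elim/big_rec2: _ => // i x y _ <-; case: (b i) => ? ?; case: y.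
exists (s1 +i* s2)%C => n; apply/ler_addgt0Pr => e e0.
have e20 : 0 < e / 2 by rewrite divr_gt0.
have [N1 HN1] := H1 _ e20; have [N2 HN2] := H2 _ e20.
pose m := maxn n (maxn N1 N2).
have nm : (n <= m)%N by rewrite leq_maxl.
have N1m : (N1 <= m)%N by rewrite !leq_max leqnn !orbT.
have N2m : (N2 <= m)%N by rewrite !leq_max leqnn !orbT.
apply: le_trans (ler_normc_distD (\sum_(k < m) b k) _ _) _.
rewrite addrC; apply: lerD.
  rewrite -!(big_mkord xpredT) (big_cat_nat (leq0n n) nm) /= addrAC subrr add0r.
  apply: le_trans (ler_normc_sum _ _ _) _.
  apply: le_trans (geometric_sum_le c0 t01 nm).
  by apply: ler_sum => k _; apply: bc.
apply: le_trans (ler_normc_ReIm _) _.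
move: (HN1 _ N1m) (HN2 _ N2m); rewrite -ReS -ImS.
case: (\sum_(k < m) b k) => u v /= /ltW h1 /ltW h2.
by rewrite [e]splitr lerD.
Qed.

End GeometricSeries.

(** * Power series and divided differences *)

Section PowerSeries.
Variable R : realType.
Implicit Types (f F G : R[i] -> R[i]) (a b u : nat -> R[i]) (l z w mu : R[i]).
Implicit Types (c rho e d t : R).

Definition psum a n w := \sum_(k < n) a k * w ^+ k.

Lemma psumS a n w : psum a n.+1 w = psum a n w + a n * w ^+ n.
Proof. by rewrite /psum big_ord_recr. Qed.

Lemma psum0 a w : psum a 0 w = 0.
Proof. by rewrite /psum big_ord0. Qed.

(* Power series expansions are recorded through explicit error bounds, valid on
   the disc [rho * |z - l| <= 1/2], so that no limit has to be taken. *)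
Definition has_pseries f l c rho a :=
  (forall k, normc (a k) <= c * rho ^+ k) /\
  forall z, rho * normc (z - l) <= 2^-1 ->
    forall n, normc (f z - psum a n (z - l)) <= 2 * c * (rho * normc (z - l)) ^+ n.

(** [rho] is an inverse radius, so enlarging it shrinks the disc; finitely many expansions can thus
    share their constants. *)
Lemma has_pseries_le f l c c' rho rho' a : c <= c' -> 0 <= rho <= rho' ->
  has_pseries f l c rho a -> has_pseries f l c' rho' a.
Proof.
move=> cc' /andP[rho0 rr'] [ac fc]; have c0 := ge0_of_geometric ac.
split=> [k|z zl n].
  apply: le_trans (ac k) _; apply: ler_pM => //; first exact: exprn_ge0.
  by rewrite lerXn2r // nnegrE (le_trans rho0).
have rz : rho * normc (z - l) <= rho' * normc (z - l).
  by rewrite ler_wpM2r ?normc_ge0.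
apply: le_trans (fc z (le_trans rz zl) n) _.
apply: ler_pM; rewrite ?mulr_ge0 ?exprn_ge0 ?mulr_ge0 ?normc_ge0 ?ler_wpM2l //.
by rewrite lerXn2r // nnegrE mulr_ge0 ?normc_ge0 // (le_trans rho0).
Qed.

Lemma has_pseries_bound f l c rho a z : has_pseries f l c rho a ->
  rho * normc (z - l) <= 2^-1 -> normc (f z) <= 2 * c.
Proof. by move=> [_ fc] /fc /(_ 0%N); rewrite psum0 subr0 mulr1. Qed.

Lemma pseries_cvg a c rho w : 0 <= rho -> (forall k, normc (a k) <= c * rho ^+ k) ->
  rho * normc w <= 2^-1 ->
  exists s, forall n, normc (s - psum a n w) <= 2 * c * (rho * normc w) ^+ n.
Proof.
move=> rho0 ac rw; apply: (@geometric_cvg _ (fun k => a k * w ^+ k)).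
  by rewrite rw mulr_ge0 // normc_ge0.
move=> k; rewrite Normc.normcM normcX exprMn mulrA.
by rewrite ler_wpM2r // exprn_ge0 // normc_ge0.
Qed.

Lemma cvg_normc_lt (s : nat -> R[i]) (x : R[i]) : s @ \oo --> x ->
  forall e, 0 < e -> exists N, forall n, (N <= n)%N -> normc (x - s n) < e.
Proof.
move=> /cvgrPdist_lt H e e0; have [|N _ HN] := H e%:C%C; first by rewrite ltcR.
by exists N => n /HN; rewrite normr_normc ltcR.
Qed.

Lemma analytic_has_pseries f (D : set R[i]) l : analytic_on f D -> D l ->
  exists c rho a, 0 < rho /\ has_pseries f l c rho a.
Proof.
move=> fD /fD [a /nbhs_normcP [d d0 Hd]].
have cv z : normc (z - l) < d -> forall e, 0 < e -> exists N, forall n,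
    (N <= n)%N -> normc (f z - psum a n (z - l)) < e.
  move=> /Hd /cvg_normc_lt H e /H [N HN]; exists N => n /HN.
  by rewrite /series /= big_mkord.
pose w : R[i] := (d / 2)%:C%C.
have nw : normc w = d / 2 by rewrite normcR ger0_norm // divr_ge0 // ltW.
have [||N HN] := cv (l + w) _ 1; rewrite ?[l + w - l]addrAC ?subrr ?add0r //.
  by rewrite nw ltr_pdivrMr // ltr_pMr // ltr1n.
(* Convergence at [w], of modulus [1 / rho], bounds [a k / rho ^ k]; the disc of validity has radius
   [d / 4]. *)
pose rho := 2 / d; have rho0 : 0 < rho by rewrite divr_gt0.
have wr : normc w = rho^-1 by rewrite nw /rho invf_div.
(* From index [N] on, a term is the difference of two partial sums within 1 of [f (l + w)], hence at
   most 2; the sum covers the earlier terms. *)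
pose c := 2 + \sum_(k < N) normc (a k) * normc w ^+ k.
have c0 : 0 <= c by rewrite addr_ge0 // sumr_ge0 // => k _; rewrite mulr_ge0 ?exprn_ge0 ?normc_ge0.
have ac k : normc (a k) <= c * rho ^+ k.
  rewrite -[rho]invrK -wr exprVn -[_ / _]/(_ * _) ler_pdivlMr; last first.
    by rewrite exprn_gt0 // wr invr_gt0.
  have [Nk|kN] := leqP N k.
    have := HN _ Nk; have := HN _ (leqW Nk); rewrite addrAC subrr add0r psumS => h1 h2.
    rewrite -normcX -Normc.normcM.
    have -> : a k * w ^+ k = (f (l + w) - psum a k w) - (f (l + w) - (psum a k w + a k * w ^+ k)).
      by ring.
    apply: le_trans (ler_normcB _ _) _; apply: le_trans (lerD (ltW h2) (ltW h1)) _.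
    by rewrite lerDl sumr_ge0 // => i _; rewrite mulr_ge0 ?exprn_ge0 ?normc_ge0.
  rewrite /c (bigD1 (Ordinal kN)) //= addrCA lerDl addr_ge0 // sumr_ge0 // => i _.
  by rewrite mulr_ge0 ?exprn_ge0 ?normc_ge0.
exists c, rho, a; split=> //; split=> // z zl n.
have [s Hs] := pseries_cvg (ltW rho0) ac zl.
suff -> : f z = s by apply: Hs.
have zd : normc (z - l) < d.
  move: zl; rewrite /rho mulrAC ler_pdivrMr // => zl.
  have := normc_ge0 (z - l); lra.
apply/eqP; rewrite -subr_eq0 -normc_eq0 eq_le normc_ge0 andbT.
apply/ler_addgt0Pr => e e0; rewrite add0r.
have [M HM] := cv z zd _ e0.
pose p m := normc (f z - s) - e <= 2 * c * (rho * normc (z - l)) ^+ m.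
have pM m : (M <= m)%N -> p m.
  move=> /HM /ltW h; rewrite /p lerBlDl.
  apply: le_trans (ler_normc_distD (psum a m (z - l)) _ _) _.
  by apply: lerD => //; rewrite normc_distC.
rewrite -subr_le0; apply: (@ler0_half_expn _ _ (2 * c)) => m.
apply: le_trans (pM (maxn M m) (leq_maxl _ _)) _; rewrite ler_wpM2l ?mulr_ge0 //.
have t0 : 0 <= rho * normc (z - l) by rewrite mulr_ge0 ?normc_ge0 // ltW.
apply: le_trans (_ : (rho * normc (z - l)) ^+ m <= _).
  by rewrite ler_wiXn2l ?leq_maxr // (le_trans zl) // invf_le1 // ler1n.
by rewrite lerXn2r // nnegrE.
Qed.

(** Synthetic division by [w - m]: the recursion telescopes, and [u n * w ^+ n] is what remains
    after [n] terms. *)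
Lemma psum_divided_difference a u n w (m : R[i]) : (forall k, u k = a k + m * u k.+1) ->
  (w - m) * psum (fun k => u k.+1) n w = psum a n w - u 0%N + u n * w ^+ n.
Proof.
move=> uE; elim: n => [|n IHn]; first by rewrite !psum0 mulr0 mulr1 add0r addNr.
rewrite !psumS mulrDr IHn exprS {1}[u n]uE; ring.
Qed.

(* [u k] is the Horner remainder [a k + a k.+1 m + a k.+2 m^2 + ...]. *)
Lemma horner_remainders F l c rho a mu : 0 < rho -> has_pseries F l c rho a ->
  normc (F mu) <= 2 * c ->
  rho * normc (mu - l) <= 2^-1 \/ 2 <= rho * normc (mu - l) ->
  exists u, [/\ u 0%N = F mu, forall n, u n = a n + (mu - l) * u n.+1
              & forall n, normc (u n) <= 2 * c * rho ^+ n].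
Proof.
move=> rho0 [ac Fc] Fmu; set m := mu - l => Hm; have c0 := ge0_of_geometric ac.
(* At the centre the quotients by [m ^+ n] make no sense, and the coefficients themselves are the
   remainders. *)
have [m0|m0] := eqVneq m 0.
  exists a; split=> [||n].
  - have := Fc mu; rewrite -/m m0 Normc.normc0 mulr0 => /(_ _ 1%N).
    rewrite expr1 mulr0 invr_ge0 ler0n psumS psum0 add0r expr0 mulr1 => /(_ isT).
    by move=> h; apply/esym/eqP; rewrite -subr_eq0 -normc_eq0 eq_le h normc_ge0.
  - by move=> n; rewrite m0 mul0r addr0.
  - by apply: le_trans (ac n) _; rewrite ler_wpM2r ?exprn_ge0 ?(ltW rho0) //; lra.
pose u n := (F mu - psum a n m) / m ^+ n.
have uE n : u n = a n + m * u n.+1.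
  by rewrite /u psumS exprS; field; rewrite m0 expf_neq0.
have nm0 : 0 < normc m by rewrite lt_def normc_eq0 m0 normc_ge0.
exists u; split=> // [|n]; first by rewrite /u psum0 subr0 expr0 divr1.
case: Hm => Hm.
  rewrite /u Normc.normcM Normc.normcV normcX ler_pdivrMr ?exprn_gt0 //.
  by rewrite -(mulrA (2 * c)) -exprMn; apply: Fc.
(* Far from the centre the series need not converge, but the recursion [u n.+1 = (u n - a n) / m] is
   stable: with [|m| >= 2 / rho] the constant becomes [(2 c + c) / 2 <= 2 c]. *)
elim: n => [|n IHn]; first by rewrite /u psum0 subr0 expr0 divr1 mulr1.
have mu1 : m * u n.+1 = u n - a n by rewrite (uE n) addrC addKr.
rewrite -(ler_pM2l nm0) -Normc.normcM mu1.
apply: le_trans (ler_normcB _ _) _; apply: le_trans (lerD IHn (ac n)) _.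
rewrite exprS; have := exprn_ge0 n (ltW rho0); set p := rho ^+ n => p0.
have : 0 <= (rho * normc m - 2) * (c * p) by rewrite mulr_ge0 ?mulr_ge0 ?subr_ge0.
have : 0 <= c * p by rewrite mulr_ge0.
by set q := normc m; lra.
Qed.

(** 5/2 = 2 + 1/2: a point in the disc of one centre, where [rho * |mu - l| <= 1/2], satisfies
    [2 <= rho * |mu - l'|] for every other centre, the second regime of [horner_remainders]. *)
Definition separated (L : seq R[i]) rho := {in L &, forall l l', l != l' ->
  5 / 2 <= rho * normc (l - l')}.

Definition in_discs (L : seq R[i]) rho mu :=
  exists2 l, l \in L & rho * normc (mu - l) <= 2^-1.

(** At each centre the coefficients of [G] are the Horner remainders shifted by one. They obey a
    bound with the same [rho], wherever [mu] lies in the discs, so the division can be iterated. *)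
Lemma divided_difference (L : seq R[i]) F c rho mu : 0 < rho -> separated L rho ->
  {in L, forall l, exists a, has_pseries F l c rho a} -> in_discs L rho mu ->
  exists G, {in L, forall l, exists a, has_pseries G l (2 * c * rho) rho a} /\
            forall z, F z = F mu + (z - mu) * G z.
Proof.
move=> rho0 sepL FL [l0 Ll0 mul0].
have Fmu : normc (F mu) <= 2 * c.
  by have [a Ha] := FL _ Ll0; apply: has_pseries_bound Ha mul0.
have /choice[v Hv] : forall l, exists u, l \in L ->
    [/\ u 0%N = F mu, forall k, normc (u k.+1) <= 2 * c * rho * rho ^+ k
      & exists2 a, has_pseries F l c rho a &
        forall n, u n = a n + (mu - l) * u n.+1].
  move=> l; have [Ll|//] := boolP (l \in L); last by exists (fun=> 0).
  have [a Ha] := FL l Ll.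
  have [|u [u0 uE uc]] := horner_remainders rho0 Ha Fmu.
    have [->|ll0] := eqVneq l l0; first by left.
    right; have := sepL l l0 Ll Ll0 ll0.
    have : rho * normc (l - l0) <= rho * normc (mu - l) + rho * normc (mu - l0).
      by rewrite -mulrDr ler_pM2l // (normc_distC mu l) ler_normc_distD.
    by lra.
  exists u => _; split=> // [k|]; last by exists a.
  by apply: le_trans (uc k.+1) _; rewrite exprS mulrA.
pose b l k := v l k.+1.
have r0 : 0 <= rho by exact: ltW.
have bc l : l \in L -> forall k, normc (b l k) <= 2 * c * rho * rho ^+ k.
  by move=> /Hv[].
have [s0 Hs0] := pseries_cvg r0 (bc _ Ll0) mul0.
(* The value at [mu] is the one forced by the expansion at [l0], whose disc contains [mu]. *)
pose G z := if z == mu then s0 else (F z - F mu) / (z - mu).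
exists G; split=> [l Ll|z]; last first.
  rewrite /G; case: eqVneq => [->|zmu]; first by rewrite subrr mul0r addr0.
  by rewrite mulrC divfK ?subr_eq0 // addrC subrK.
exists (b l); split=> [|z zl n]; first exact: bc.
have [s Hs] := pseries_cvg r0 (bc _ Ll) zl.
rewrite /G; case: eqVneq => [zmu|zmu].
  (* By separation, [mu] lies in the disc of [l0] only. *)
  have -> : l = l0; last by rewrite zmu; apply: Hs0.
  apply/eqP/negPn/negP => /(sepL _ _ Ll Ll0); move: zl; rewrite zmu => mul.
  have : rho * normc (l - l0) <= rho * normc (mu - l) + rho * normc (mu - l0).
    by rewrite -mulrDr ler_pM2l // (normc_distC mu l) ler_normc_distD.
  by lra.
have [u0 _ [a [ac Fc] uE]] := Hv l Ll.
suff -> : (F z - F mu) / (z - mu) = s by apply: Hs.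
suff /eqP : (z - mu) * s - (F z - F mu) = 0.
  by rewrite subr_eq0 => /eqP <-; rewrite mulrC mulKf // subr_eq0.
set w := z - l in zl Hs *; set t := rho * normc w in zl Hs *.
apply: (@normc_half_expn_eq0 _ _
  (normc (z - mu) * (2 * (2 * c * rho)) + 2 * c + 2 * c)) => {}n.
have E : (z - mu) * s - (F z - F mu) = (z - mu) * (s - psum (b l) n w)
    - (F z - psum a n w) + v l n * w ^+ n.
  have := psum_divided_difference n w uE; rewrite -/(b l) u0.
  have -> : w - (mu - l) = z - mu by rewrite /w; ring.
  rewrite mulrBr => ->; ring.
have c0 := ge0_of_geometric ac.
have tn : t ^+ n <= 2^-1 ^+ n.
  by rewrite lerXn2r // nnegrE ?invr_ge0 // mulr_ge0 ?normc_ge0.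
have vn : normc (v l n * w ^+ n) <= 2 * c * 2^-1 ^+ n.
  rewrite Normc.normcM normcX; apply: le_trans (_ : 2 * c * t ^+ n <= _); last first.
    by rewrite ler_wpM2l // mulr_ge0.
  rewrite exprMn mulrA ler_wpM2r ?exprn_ge0 ?normc_ge0 //.
  case: n {E tn} => [|n]; first by rewrite u0 mulr1.
  by rewrite exprS mulrA; apply: bc.
rewrite E 2!(mulrDl _ _ (2^-1 ^+ n)); apply: le_trans (ler_normcD _ _) _; apply: lerD => //.
apply: le_trans (ler_normcB _ _) _; apply: lerD.
  rewrite Normc.normcM -[leRHS]mulrA ler_wpM2l ?normc_ge0 //.
  by apply: le_trans (Hs n) _; rewrite ler_wpM2l // !mulr_ge0.
by apply: le_trans (Fc z zl n) _; rewrite ler_wpM2l // mulr_ge0.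
Qed.

End PowerSeries.

(** * Derivatives of power series *)

Section PowerSeriesDerivative.
Variable R : realType.
Implicit Types (f : R[i] -> R[i]) (a : nat -> R[i]) (l z w d D : R[i]).
Implicit Types (c rho r e K : R).

(** Second order Taylor remainder of a power. The factor [r ^+ 2] avoids the exponent [n - 2], and
    [4 ^ n] crudely replaces [n (n - 1) / 2]. *)
Lemma normc_exprB_le r z w n : normc z <= r -> normc w <= r ->
  normc (z ^+ n - w ^+ n - n%:R * (z - w) * w ^+ n.-1) * r ^+ 2
    <= normc (z - w) ^+ 2 * (4 * r) ^+ n.
Proof.
move=> zr wr; have r0 := le_trans (normc_ge0 z) zr.
elim: n => [|n IHn].
  rewrite !expr0 subrr mul0r sub0r mul0r oppr0 Normc.normc0 mul0r.
  by rewrite mulr_ge0 // exprn_ge0 // normc_ge0.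
have -> : z ^+ n.+1 - w ^+ n.+1 - n.+1%:R * (z - w) * w ^+ n =
    z * (z ^+ n - w ^+ n - n%:R * (z - w) * w ^+ n.-1)
    + n%:R * ((z - w) ^+ 2 * w ^+ n.-1).
  by case: n {IHn} => [|n]; rewrite /= ?exprS -?natr1; ring.
apply: le_trans (_ : (r * normc (z ^+ n - w ^+ n - n%:R * (z - w) * w ^+ n.-1)
   + n%:R * (normc (z - w) ^+ 2 * r ^+ n.-1)) * r ^+ 2 <= _).
  rewrite ler_wpM2r ?exprn_ge0 //.
  apply: le_trans (ler_normcD _ _) _; rewrite !Normc.normcM !normcX normc_nat.
  apply: lerD; first by rewrite ler_wpM2r ?normc_ge0.
  rewrite !ler_wpM2l ?mulr_ge0 ?normc_ge0 //.
  by rewrite lerXn2r // nnegrE normc_ge0.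
have -> : (4 * r) ^+ n.+1 = r * (4 * r) ^+ n + 3 * 4 ^+ n * r ^+ n.+1.
  rewrite !exprMn !exprS; ring.
rewrite [leLHS]mulrDl [leRHS]mulrDr; apply: lerD; first by rewrite -mulrA [leRHS]mulrCA ler_wpM2l.
case: n {IHn} => [|n]; first by rewrite !mul0r !mulr_ge0 ?exprn_ge0 ?normc_ge0.
have -> : n.+1%:R * (normc (z - w) ^+ 2 * r ^+ n) * r ^+ 2
   = normc (z - w) ^+ 2 * (n.+1%:R * r ^+ n.+2) by rewrite /= !exprS expr0; ring.
rewrite ler_wpM2l ?exprn_ge0 ?normc_ge0 // ler_wpM2r ?exprn_ge0 //.
rewrite -!natrX -natrM ler_nat (leq_trans (ltnW (ltn_expl _ (isT : 1 < 4)%N))) //.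
by rewrite leq_pmull.
Qed.

Definition psderiv a k : R[i] := k.+1%:R * a k.+1.

Lemma psum_deriv a n w :
  \sum_(k < n.+1) a k * (k%:R * w ^+ k.-1) = psum (psderiv a) n w.
Proof.
rewrite big_ord_recl /= mul0r mulr0 add0r; apply: eq_bigr => k _.
by rewrite /psderiv /= /bump /= add1n; ring.
Qed.

Lemma psderiv_bound c rho a : 0 <= rho -> (forall k, normc (a k) <= c * rho ^+ k) ->
  forall k, normc (psderiv a k) <= c * rho * (8 * rho) ^+ k.
Proof.
move=> rho0 ac k; have c0 := ge0_of_geometric ac.
rewrite Normc.normcM normc_nat.
apply: le_trans (_ : k.+1%:R * (c * rho ^+ k.+1) <= _); first by rewrite ler_wpM2l.
rewrite exprMn exprS mulrCA -!mulrA ler_wpM2l // mulrCA ler_wpM2l //.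
rewrite ler_wpM2r ?exprn_ge0 // -natrX ler_nat.
exact: ltn_expl.
Qed.

(** [D] is the sum of the differentiated series at [z0], given by its error bounds. The factor 8
    comes from here: for [r = 1 / (8 rho)] the remainders of the terms decay like
    [(4 * r * rho) ^+ k], of ratio 1/2. *)
Lemma pseries_quadratic f l c rho a z0 D : 0 < rho -> has_pseries f l c rho a ->
  8 * rho * normc (z0 - l) <= 2^-1 ->
  (forall n, normc (D - psum (psderiv a) n (z0 - l))
     <= 2 * (c * rho) * (8 * rho * normc (z0 - l)) ^+ n) ->
  forall z, 8 * rho * normc (z - l) <= 1 ->
  normc (f z - f z0 - (z - z0) * D) <= 2 * c * (8 * rho) ^+ 2 * normc (z - z0) ^+ 2.
Proof.
move=> rho0 [ac fc] z0l HD z zl; have c0 := ge0_of_geometric ac.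
have r0 : 0 <= rho by exact: ltW.
set r := (8 * rho)^-1; have rr : 0 < r by rewrite invr_gt0 mulr_gt0.
set w := z - l in zl *; set w0 := z0 - l in z0l HD *.
have wr : normc w <= r by rewrite /r -[leRHS]mul1r ler_pdivlMr ?mulr_gt0 // mulrC.
have wr0 : normc w0 <= r.
  rewrite /r -[leRHS]mul1r ler_pdivlMr ?mulr_gt0 // mulrC.
  by apply: le_trans z0l _; rewrite invf_le1 // ler1n.
have zw : z - z0 = w - w0 by rewrite /w /w0; ring.
have rho_r : 8 * rho * r = 1 by rewrite /r divff // gt_eqF ?mulr_gt0.
pose e k := w ^+ k - w0 ^+ k - k%:R * (w - w0) * w0 ^+ k.-1.
have sum_e n : normc (\sum_(k < n) a k * e k) <= 2 * c * (8 * rho) ^+ 2 * normc (z - z0) ^+ 2.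
  pose q := c * (8 * rho) ^+ 2 * normc (z - z0) ^+ 2.
  have q0 : 0 <= q by rewrite !mulr_ge0 ?exprn_ge0 ?normc_ge0 ?mulr_ge0.
  apply: le_trans (_ : \sum_(0 <= k < n) q * 2^-1 ^+ k <= _); last first.
    apply: le_trans (geometric_sum_le q0 _ (leq0n n)) _.
      by rewrite lexx invr_ge0 ler0n.
    by rewrite expr0 mulr1 /q !mulrA.
  rewrite big_mkord; apply: le_trans (ler_normc_sum _ _ _) _; apply: ler_sum => k _.
  rewrite Normc.normcM.
  have := normc_exprB_le k wr wr0; rewrite -/(e k) -zw => ek.
  have : normc (e k) <= (8 * rho) ^+ 2 * (normc (z - z0) ^+ 2 * (4 * r) ^+ k).
    have -> : normc (e k) = (8 * rho) ^+ 2 * (normc (e k) * r ^+ 2).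
      by rewrite mulrCA -exprMn rho_r expr1n mulr1.
    by rewrite ler_wpM2l ?exprn_ge0 ?mulr_ge0.
  move=> {}ek; apply: le_trans (ler_pM (normc_ge0 _) (normc_ge0 _) (ac k) ek) _.
  have -> : c * rho ^+ k * ((8 * rho) ^+ 2 * (normc (z - z0) ^+ 2 * (4 * r) ^+ k))
     = q * (rho * (4 * r)) ^+ k by rewrite (exprMn k rho (4 * r)) /q; ring.
  have -> : rho * (4 * r) = 2^-1 by move: rho_r; lra.
  by [].
pose K := 2 * c + 2 * c + normc (z - z0) * (2 * (c * rho)).
have bound n : normc (f z - f z0 - (z - z0) * D) <=
    K * 2^-1 ^+ n + 2 * c * (8 * rho) ^+ 2 * normc (z - z0) ^+ 2.
  have -> : f z - f z0 - (z - z0) * D = (f z - psum a n.+1 w) - (f z0 - psum a n.+1 w0)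
     - (z - z0) * (D - psum (psderiv a) n w0) + \sum_(k < n.+1) a k * e k.
    have -> : \sum_(k < n.+1) a k * e k =
        psum a n.+1 w - psum a n.+1 w0 - (z - z0) * psum (psderiv a) n w0.
      rewrite -psum_deriv mulr_sumr /psum -!sumrB; apply: eq_bigr => k _.
      by rewrite /e zw; ring.
    by ring.
  have half (t : R) : 0 <= t -> t <= 2^-1 -> t ^+ n.+1 <= 2^-1 ^+ n.
    move=> t0 t1; apply: le_trans (_ : 2^-1 ^+ n.+1 <= _).
      by rewrite lerXn2r // nnegrE invr_ge0.
    by rewrite exprS ler_piMl ?exprn_ge0 ?invr_ge0 // invf_le1 // ler1n.
  have small (v : R[i]) : 8 * rho * normc v <= 1 -> rho * normc v <= 2^-1.
    by have := mulr_ge0 r0 (normc_ge0 v); lra.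
  apply: le_trans (ler_normcD _ _) _; apply: lerD => //.
  rewrite /K 2!(mulrDl _ _ (2^-1 ^+ n)); apply: le_trans (ler_normcB _ _) _; apply: lerD.
    apply: le_trans (ler_normcB _ _) _; apply: lerD.
      apply: le_trans (fc z _ n.+1) _; first exact: small.
      by rewrite ler_wpM2l ?mulr_ge0 // half ?mulr_ge0 ?normc_ge0 // small.
    have z0l' : rho * normc w0 <= 2^-1 by apply: small; apply: le_trans z0l _; lra.
    apply: le_trans (fc z0 z0l' n.+1) _.
    by rewrite ler_wpM2l ?mulr_ge0 // half ?mulr_ge0 ?normc_ge0.
  rewrite Normc.normcM -[leRHS]mulrA ler_wpM2l ?normc_ge0 //.
  apply: le_trans (HD n) _; rewrite ler_wpM2l ?mulr_ge0 //.
  by rewrite lerXn2r // nnegrE ?invr_ge0 ?mulr_ge0 ?normc_ge0.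
rewrite -subr_le0; apply: (@ler0_half_expn _ _ K) => n; by rewrite lerBlDr.
Qed.

Lemma derive1_quadratic f z0 D K (del : R) : 0 < del ->
  (forall z, normc (z - z0) < del ->
     normc (f z - f z0 - (z - z0) * D) <= K * normc (z - z0) ^+ 2) ->
  f^`()%classic z0 = D.
Proof.
move=> del0 H; rewrite /derive1; apply: cvg_lim; first exact: norm_hausdorff.
apply/cvgrPdist_le => e e0.
have [er er0 Ee] : exists2 er : R, 0 < er & e = er%:C%C.
  move: e0; rewrite ltcE /= => /andP[/eqP e1 e2].
  by exists (complex.Re e) => //; apply/eqP; rewrite eq_complex /= e1 !eqxx.
rewrite near_withinE; apply/nbhs_normcP.
exists (Num.min del (er / (`|K| + 1))); first by rewrite lt_min del0 divr_gt0 // ltr_wpDl.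
move=> h; rewrite subr0 lt_min => /andP[hd he] h0.
have nh0 : 0 < normc h by rewrite lt_def normc_eq0 h0 normc_ge0.
rewrite Ee normr_normc lecR.
have hz : h + z0 - z0 = h by rewrite addrK.
have := H (h + z0); rewrite hz => /(_ hd) HK.
have -> : D - h^-1 *: (f (h + z0) - f z0) = - (h^-1 * (f (h + z0) - f z0 - h * D)).
  by rewrite mulrBr mulKf // opprB.
rewrite normc_opp Normc.normcM Normc.normcV ler_pdivrMl //.
apply: le_trans HK _; rewrite expr2 mulrCA ler_wpM2l ?normc_ge0 //.
apply: le_trans (_ : (`|K| + 1) * normc h <= _).
  by rewrite ler_wpM2r ?normc_ge0 // ler_wpDr // ler_norm.
by move: he; rewrite ltr_pdivlMr ?ltr_wpDl // mulrC => /ltW.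
Qed.

Lemma derive1_has_pseries f l c rho a : 0 < rho -> has_pseries f l c rho a ->
  has_pseries f^`()%classic l (c * rho) (8 * rho) (psderiv a).
Proof.
move=> rho0 fc; have [ac _] := fc; have r0 : 0 <= rho by exact: ltW.
have bc := psderiv_bound r0 ac.
split=> // z zl; have [D HD] := pseries_cvg (mulr_ge0 (ler0n _ 8) r0) bc zl.
suff -> : f^`()%classic z = D by [].
have q := pseries_quadratic rho0 fc zl HD.
apply: (@derive1_quadratic _ _ _ (2 * c * (8 * rho) ^+ 2) (2^-1 / (8 * rho))).
  by rewrite divr_gt0 // mulr_gt0.
move=> y; rewrite ltr_pdivlMr ?mulr_gt0 // => yz; apply: q.
have : 8 * rho * normc (y - l) <= 8 * rho * (normc (y - z) + normc (z - l)).
  by rewrite ler_wpM2l ?ler_normc_distD ?mulr_ge0.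
by move: yz zl; lra.
Qed.

(** Each differentiation shrinks the disc by a factor 8, which is harmless: only the value at the
    centre is wanted. *)
Lemma derive1n_has_pseries f l c rho a k : 0 < rho -> has_pseries f l c rho a ->
  derive1n k f l = a k *+ k`!.
Proof.
elim: k f c rho a => [|k IHk] f c rho a rho0 fc.
  rewrite fact0 mulr1n derive1n0; have [_ /(_ l)] := fc; rewrite subrr Normc.normc0 mulr0.
  rewrite invr_ge0 ler0n => /(_ isT 1%N); rewrite psumS psum0 expr1 mulr0 add0r expr0 mulr1 => h.
  by apply/eqP; rewrite -subr_eq0 -normc_eq0 eq_le h normc_ge0.
rewrite derive1Sn (IHk _ (c * rho) (8 * rho) (psderiv a)) ?mulr_gt0 //; last first.
  exact: derive1_has_pseries.
by rewrite /psderiv mulr_natl -mulrnA factS mulnC.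
Qed.

(** By strong induction, the first coefficient [b k] of [f - p] that could be nonzero satisfies
    [|b k| <= K3 * |w|] for all small [w] other than 0, and [w = del * 2^-n] forces it to vanish. *)
Lemma eq_taylor_coef f (p : {poly R[i]}) l c rho a m K : 0 < rho ->
  has_pseries f l c rho a ->
  (forall z, rho * normc (z - l) <= 2^-1 -> normc (f z - p.[z]) <= K * normc (z - l) ^+ m) ->
  forall k, (k < m)%N -> (p^`(k)).[l] = derive1n k f l.
Proof.
move=> rho0 fc Hp k km; rewrite (derive1n_has_pseries k rho0 fc) nderivn_def hornerMn.
congr (_ *+ _); move: k km.
pose b k := a k - p^`N(k).[l].
suff b0 k : (k < m)%N -> b k = 0 by move=> k /b0 /eqP; rewrite subr_eq0 => /eqP.
have [ac {}fc] := fc; have c0 := ge0_of_geometric ac.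
elim/ltn_ind: k => k IHk km; pose N := maxn k.+1 (size p).
have pE z : p.[z] = \sum_(i < N) p^`N(i).[l] * (z - l) ^+ i.
  rewrite -[in LHS](subrKC l z) -nderiv_taylor_wide ?leq_maxr //; exact: mulrC.
pose K2 := \sum_(k.+1 <= i < N) normc (p^`N(i).[l]).
pose K3 := 2 * c * rho ^+ k.+1 + `|K| + K2.
pose del := Num.min 1 (2^-1 / rho).
have del0 : 0 < del by rewrite lt_min ltr01 divr_gt0.
have bw w : 0 < normc w -> normc w <= del -> normc (b k) <= K3 * normc w.
  rewrite le_min => w0 /andP[w1]; rewrite ler_pdivlMr // mulrC => wr.
  rewrite -(ler_pM2r (exprn_gt0 k w0)) -mulrA -exprS -normcX -Normc.normcM.
  have -> : b k * w ^+ k = psum b k.+1 w.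
    by rewrite psumS /psum big1 ?add0r // => i _; rewrite IHk ?mul0r // (ltn_trans _ km).
  pose z := w + l; have zl : z - l = w by rewrite addrK.
  have -> : psum b k.+1 w = (f z - p.[z]) - (f z - psum a k.+1 w)
      + \sum_(k.+1 <= i < N) p^`N(i).[l] * w ^+ i.
    rewrite pE zl -(big_mkord xpredT (fun i => p^`N(i).[l] * w ^+ i)).
    rewrite (big_cat_nat (leq0n k.+1) (leq_maxl _ _)) /= big_mkord.
    have -> : psum b k.+1 w = psum a k.+1 w - \sum_(i < k.+1) p^`N(i).[l] * w ^+ i.
      by rewrite /psum -sumrB; apply: eq_bigr => i _; rewrite mulrBl.
    by ring.
  have wn i : (k < i)%N -> normc w ^+ i <= normc w ^+ k.+1.
    by move=> ki; rewrite ler_wiXn2l // ltW.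
  rewrite /K3 2!(mulrDl _ _ (normc w ^+ _)); apply: le_trans (ler_normcD _ _) _.
  apply: lerD.
    apply: le_trans (ler_normcB _ _) _; rewrite addrC; apply: lerD.
      have := fc z; rewrite zl => /(_ wr k.+1); by rewrite exprMn mulrA.
    have := Hp z; rewrite zl => /(_ wr) h; apply: le_trans h _.
    apply: le_trans (_ : `|K| * normc w ^+ m <= _).
      by rewrite ler_wpM2r ?exprn_ge0 ?normc_ge0 // ler_norm.
    by rewrite ler_wpM2l // wn.
  apply: le_trans (ler_normc_sum _ _ _) _; rewrite mulr_suml big_nat [leRHS]big_nat.
  apply: ler_sum => i /andP[ki _].
  by rewrite Normc.normcM normcX ler_wpM2l ?normc_ge0 // wn.
apply: (@normc_half_expn_eq0 _ _ (K3 * del)) => n.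
have dn : normc ((del * 2^-1 ^+ n)%:C%C : R[i]) = del * 2^-1 ^+ n.
  by rewrite normcR ger0_norm // mulr_ge0 ?exprn_ge0 ?invr_ge0 // ltW.
have := bw (del * 2^-1 ^+ n)%:C%C; rewrite dn mulrA; apply.
  by rewrite mulr_gt0 // exprn_gt0 // invr_gt0.
by rewrite ler_piMr ?exprn_ile1 ?invr_ge0 ?invf_le1 ?ler1n // ltW.
Qed.

End PowerSeriesDerivative.

(** * Polynomial approximation of matrix functions *)

Section EntrywiseNorm.
Variable R : realType.
Implicit Types (m n p q : nat) (c : R[i]).

(** This norm is submultiplicative, additive over blocks, and real-valued, whereas the norm of a
    complex matrix takes its values in [R[i]]. *)
Definition nm m n (M : 'M[R[i]]_(m, n)) : R := \sum_i \sum_j normc (M i j).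

Lemma nm_ge0 m n (M : 'M[R[i]]_(m, n)) : 0 <= nm M.
Proof. by apply: sumr_ge0 => i _; apply: sumr_ge0 => j _; apply: normc_ge0. Qed.

Lemma nm0 m n : nm (0 : 'M[R[i]]_(m, n)) = 0.
Proof. by rewrite /nm big1 // => i _; rewrite big1 // => j _; rewrite mxE Normc.normc0. Qed.

Lemma ler_nmD m n (M N : 'M[R[i]]_(m, n)) : nm (M + N) <= nm M + nm N.
Proof.
rewrite /nm -big_split; apply: ler_sum => i _; rewrite -big_split.
by apply: ler_sum => j _; rewrite mxE ler_normcD.
Qed.

Lemma nmN m n (M : 'M[R[i]]_(m, n)) : nm (- M) = nm M.
Proof. by apply: eq_bigr => i _; apply: eq_bigr => j _; rewrite mxE normc_opp. Qed.

Lemma ler_nmB m n (M N : 'M[R[i]]_(m, n)) : nm (M - N) <= nm M + nm N.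
Proof. by rewrite -(nmN N) ler_nmD. Qed.

Lemma nmZ m n c (M : 'M[R[i]]_(m, n)) : nm (c *: M) = normc c * nm M.
Proof.
rewrite /nm mulr_sumr; apply: eq_bigr => i _; rewrite mulr_sumr.
by apply: eq_bigr => j _; rewrite mxE Normc.normcM.
Qed.

Lemma ler_normc_nm m n (M : 'M[R[i]]_(m, n)) i j : normc (M i j) <= nm M.
Proof.
rewrite /nm (bigD1 i) //= (bigD1 j) //= -addrA lerDl addr_ge0 // sumr_ge0 // => k _.
  exact: normc_ge0.
by apply: sumr_ge0 => l _; apply: normc_ge0.
Qed.

Lemma nm_eq0 m n (M : 'M[R[i]]_(m, n)) : nm M = 0 -> M = 0.
Proof.
move=> M0; apply/matrixP => i j; rewrite mxE; apply/eqP.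
by rewrite -normc_eq0 eq_le normc_ge0 andbT -M0 ler_normc_nm.
Qed.

Lemma ler_nmM m n p (M : 'M[R[i]]_(m, n)) (N : 'M[R[i]]_(n, p)) : nm (M *m N) <= nm M * nm N.
Proof.
rewrite /nm mulr_suml; apply: ler_sum => i _.
apply: le_trans (_ : \sum_j \sum_k normc (M i k) * normc (N k j) <= _).
  apply: ler_sum => j _; rewrite mxE; apply: le_trans (ler_normc_sum _ _ _) _.
  by apply: ler_sum => k _; rewrite Normc.normcM.
rewrite exchange_big mulr_suml; apply: ler_sum => k _ /=.
rewrite -mulr_sumr ler_wpM2l ?normc_ge0 // (bigD1 k) //= lerDl.
by apply: sumr_ge0 => l _; apply: sumr_ge0 => j _; apply: normc_ge0.
Qed.

Lemma nm_scalar_mx n c : nm (c%:M : 'M[R[i]]_n) = n%:R * normc c.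
Proof.
rewrite /nm (eq_bigr (fun=> normc c)) ?sumr_const ?card_ord ?mulr_natl // => i _.
rewrite (bigD1 i) //= mxE eqxx mulr1n big1 ?addr0 // => j ji.
by rewrite mxE eq_sym (negPf ji) Normc.normc0.
Qed.

Lemma nm_block_mx m n p q (A : 'M[R[i]]_(m, n)) (B : 'M[R[i]]_(m, q))
    (D : 'M[R[i]]_(p, n)) (E : 'M[R[i]]_(p, q)) :
  nm (block_mx A B D E) = nm A + nm B + nm D + nm E.
Proof.
rewrite /nm big_split_ord /= -addrA -!big_split /=; congr (_ + _);
  apply: eq_bigr => i _; rewrite big_split_ord; congr (_ + _); apply: eq_bigr => j _.
- by rewrite block_mxEul.
- by rewrite block_mxEur.
- by rewrite block_mxEdl.
- by rewrite block_mxEdr.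
Qed.

Lemma nm_ursubmx m n p q (M : 'M[R[i]]_(m + p, n + q)) : nm (ursubmx M) <= nm M.
Proof.
have := nm_ge0; rewrite -[in leRHS](submxK M) nm_block_mx => h.
have := h _ _ (ulsubmx M); have := h _ _ (dlsubmx M); have := h _ _ (drsubmx M); lra.
Qed.

Lemma ler_nm_expr n (M : 'M[R[i]]_n.+1) k : nm (M ^+ k) <= n.+1%:R * nm M ^+ k.
Proof.
elim: k => [|k IHk]; first by rewrite expr0 nm_scalar_mx Normc.normc1.
rewrite !exprS mulrCA; apply: le_trans (ler_nmM _ _) _.
by rewrite ler_wpM2l ?nm_ge0.
Qed.

Lemma horner_mx_MXaddC n (M : 'M[R[i]]_n.+1) (p : {poly R[i]}) c :
  horner_mx M (p * 'X + c%:P) = horner_mx M p *m M + c%:M.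
Proof. by rewrite rmorphD rmorphM /= horner_mx_X horner_mx_C. Qed.

Lemma horner_mx_lipschitz n (p : {poly R[i]}) (B : R) : exists C : R, 0 <= C /\
  forall M N : 'M[R[i]]_n.+1, nm M <= B -> nm N <= B ->
    nm (horner_mx M p) <= C /\ nm (horner_mx M p - horner_mx N p) <= C * nm (M - N).
Proof.
elim/poly_ind: p => [|p c [C [C0 IHp]]].
  by exists 0; split=> // M N _ _; rewrite !rmorph0 subrr nm0 mul0r.
pose C' := C * `|B| + n.+1%:R * normc c + C.
exists C'; split.
  by rewrite /C' !addr_ge0 // mulr_ge0 // normc_ge0.
move=> M N MB NB; have [IH1 IH2] := IHp M N MB NB; rewrite !horner_mx_MXaddC; split.
  apply: le_trans (ler_nmD _ _) _; rewrite nm_scalar_mx.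
  apply: le_trans (_ : C * `|B| + n.+1%:R * normc c <= _); last by rewrite lerDl.
  rewrite lerD2r; apply: le_trans (ler_nmM _ _) _.
  by rewrite ler_pM ?nm_ge0 // (le_trans MB) // ler_norm.
have -> : horner_mx M p *m M + c%:M - (horner_mx N p *m N + c%:M) =
    (horner_mx M p - horner_mx N p) *m N + horner_mx M p *m (M - N).
  by rewrite mulmxBl mulmxBr; rewrite opprD addrACA subrr addr0 [RHS]addrC subrKA.
apply: le_trans (ler_nmD _ _) _.
apply: le_trans (_ : C * `|B| * nm (M - N) + C * nm (M - N) <= _).
  apply: lerD; apply: le_trans (ler_nmM _ _) _; last by rewrite ler_wpM2r ?nm_ge0.
  by rewrite mulrAC ler_pM ?nm_ge0 // (le_trans NB) // ler_norm.
by rewrite -mulrDl ler_wpM2r ?nm_ge0 // /C' lerD2r lerDl mulr_ge0 ?normc_ge0.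
Qed.

Lemma horner_bounded (p : {poly R[i]}) (r : R) :
  exists2 K : R, 0 <= K & forall z, normc z <= r -> normc p.[z] <= K.
Proof.
elim/poly_ind: p => [|p c [K K0 IHp]].
  by exists 0 => // z _; rewrite horner0 Normc.normc0.
exists (K * `|r| + normc c) => [|z zr]; first by rewrite addr_ge0 ?mulr_ge0 ?normc_ge0.
rewrite hornerMXaddC; apply: le_trans (ler_normcD _ _) _; rewrite lerD2r Normc.normcM.
by rewrite ler_pM ?normc_ge0 ?IHp // (le_trans zr) ?ler_norm.
Qed.

(** A left eigenvector [v] satisfies [v p(M) = p(mu) v]. Applied to [q] this puts the eigenvalues
    near the roots of [q]; applied to ['X] it bounds them by [nm M]. *)
Lemma eigenvalue_horner_le n (M : 'M[R[i]]_n.+1) (p : {poly R[i]}) mu :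
  eigenvalue M mu -> normc p.[mu] <= nm (horner_mx M p).
Proof.
move=> /eigenvalueP[v vM v0].
have vp : v *m horner_mx M p = p.[mu] *: v.
  elim/poly_ind: p => [|p c IHp]; first by rewrite rmorph0 horner0 scale0r mulmx0.
  rewrite horner_mx_MXaddC mulmxDr mulmxA IHp -scalemxAl vM mul_mx_scalar hornerMXaddC.
  by rewrite scalerA scalerDl.
have nv : 0 < nm v.
  by rewrite lt_def nm_ge0 andbT; apply: contra v0 => /eqP/nm_eq0 ->.
by rewrite -(ler_pM2r nv) -nmZ -vp mulrC ler_nmM.
Qed.

End EntrywiseNorm.

(** * Hermite and Newton interpolation with uniform bounds *)

Section MatrixFunctionPolynomial.
Variable R : realType.
Local Notation C := R[i].
Implicit Types (f F G : C -> C) (p q D : {poly C}) (l z mu : C) (L r ms : seq C).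
Implicit Types (c rho del B K : R).

(** Characteristic zero enters here: the derivative of order [k.+1] of [E * ('X - l)] at [l] is
    [k.+1] times that of order [k] of [E]. *)
Lemma dvdp_exp_XsubC_derivn D l m : (forall k, (k < m)%N -> (D^`(k)).[l] = 0) ->
  ('X - l%:P) ^+ m %| D.
Proof.
elim: m D => [|m IHm] D D0; first by rewrite expr0 dvd1p.
have /factor_theorem[E DE] : root D l by apply/rootP/(D0 0%N).
rewrite DE exprSr dvdp_mul2r ?polyXsubC_eq0 //; apply: IHm => k km.
have := D0 k.+1 km; rewrite DE.
have -> : E * ('X - l%:P) = (E * 'X + 0%:P) - l *: E.
  by rewrite mulrBr polyC0 addr0 -mul_polyC [l%:P * E]mulrC.
rewrite derivnB derivnZ derivnMXaddC !hornerE hornerMn.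
rewrite mulrC addrK => /eqP; rewrite mulrn_eq0 /= => /eqP //.
Qed.

(** If the cofactor of [gcdp q D] in [q] were not constant, one of its roots would have a larger
    multiplicity in [q] than in the gcd. *)
Lemma dvdp_mup q D : q != 0 -> (forall l, root q l -> ('X - l%:P) ^+ mup l q %| D) ->
  q %| D.
Proof.
move=> q0 H; have /dvdpP[h qE] := dvdp_gcdl q D.
have [h0 g0] : h != 0 /\ gcdp q D != 0.
  by move: q0; rewrite {1}qE mulf_eq0 negb_or => /andP[].
have [sh|] := eqVneq (size h) 1%N.
  move: sh => /eqP/size_poly1P[c c0 hE].
  rewrite qE hE mul_polyC dvdpZl // dvdp_gcdr //.
move=> /closed_rootP[x hx].
have qx : root q x by rewrite qE rootM hx.
have := H x qx; have : ('X - x%:P) ^+ mup x q %| q by rewrite -mup_geq.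
move=> d1 d2; have : ('X - x%:P) ^+ mup x q %| gcdp q D by rewrite dvdp_gcd d1.
rewrite -mup_geq // {1}qE mupM // -{2}[mup x (gcdp q D)]add0n leq_add2r leqn0 => /eqP h1.
by move: hx; rewrite -dvdp_XsubCl XsubC_dvd // h1.
Qed.

Lemma matfun_interpolant f n (M : 'M[C]_n.+1) p : hermite_interpolant f M p ->
  matfun f M = horner_mx M p.
Proof.
move=> Hp; rewrite /matfun; set s := xget 0 _.
have Hs : hermite_interpolant f M s by apply: (@xgetPex _ 0); exists p.
apply/eqP; rewrite -subr_eq0 -rmorphB; apply/eqP/mxminpoly_minP.
apply: dvdp_mup => [|l]; first by rewrite monic_neq0 // mxminpoly_monic.
rewrite -eigenvalue_root_min => Ml; apply: dvdp_exp_XsubC_derivn => k kl.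
by rewrite derivnB hornerD hornerN Hs // Hp // subrr.
Qed.

(** The minimal polynomial divides the characteristic one, so the local bound vanishes at [mu] to
    the order required, and [eq_taylor_coef] turns it into equalities of derivatives. *)
Lemma hermite_interpolant_near f (Omega : set C) n (M : 'M[C]_n.+1) p :
  analytic_on f Omega -> spectrum M `<=` Omega ->
  (forall mu, eigenvalue M mu -> exists del K, 0 < del /\
     forall z, normc (z - mu) < del ->
       normc (f z - p.[z]) <= K * normc (char_poly M).[z]) ->
  hermite_interpolant f M p.
Proof.
move=> fO MO H mu Mmu k km.
have [c [rho [a [rho0 fa]]]] := analytic_has_pseries fO (MO _ Mmu).
have [del [K [del0 HK]]] := H mu Mmu.
(* Adding [del^-1] keeps the disc of the expansion inside the ball of radius [del]. *)
pose rho' := rho + del^-1; have rr : rho <= rho' by rewrite lerDl invr_ge0 ltW.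
have rho'0 : 0 < rho' by apply: lt_le_trans rr.
have {}fa : has_pseries f mu c rho' a by apply: has_pseries_le fa; rewrite // ltW.
have [E chE] : exists E, char_poly M = E * ('X - mu%:P) ^+ mup mu (mxminpoly M).
  apply/dvdpP; apply: dvdp_trans (mxminpoly_dvd_char M).
  by rewrite -mup_geq // monic_neq0 // mxminpoly_monic.
have [KE KE0 HE] := horner_bounded E (normc mu + del).
apply: (eq_taylor_coef (K := `|K| * KE) rho'0 fa) km => z zmu.
have zd : normc (z - mu) < del.
  have : del^-1 * normc (z - mu) <= rho' * normc (z - mu).
    by rewrite ler_wpM2r ?normc_ge0 // lerDr ltW.
  move=> h; have := le_trans h zmu; rewrite mulrC ler_pdivrMr // => {}h; lra.
apply: le_trans (HK z zd) _; rewrite chE hornerM horner_exp hornerXsubC.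
rewrite Normc.normcM normcX mulrA ler_wpM2r ?exprn_ge0 ?normc_ge0 //.
apply: le_trans (_ : `|K| * normc E.[z] <= _).
  by rewrite ler_wpM2r ?normc_ge0 // ler_norm.
rewrite ler_wpM2l // HE // -(subrK mu z).
by rewrite addrC; apply: le_trans (ler_normcD _ _) _; rewrite lerD2l ltW.
Qed.

(** This follows the Newton form [F mu + (X - mu) p]: [2 * c] bounds [F mu], [B + n * B] bounds
    [M - mu], and [2 * c * rho] is the constant of the divided difference. The positions of the
    nodes do not enter. *)
Fixpoint newton_bound rho (n : nat) B k c : R :=
  if k is k'.+1 then n%:R * (2 * c) + (B + n%:R * B) * newton_bound rho n B k' (2 * c * rho)
  else 0.

Lemma newton_bound_ge0 rho n B k c : 0 <= rho -> 0 <= B -> 0 <= c ->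
  0 <= newton_bound rho n B k c.
Proof.
move=> rho0 B0; elim: k c => //= k IHk c c0.
by rewrite addr_ge0 ?mulr_ge0 ?addr_ge0 ?mulr_ge0 // IHk ?mulr_ge0.
Qed.

(** Each node costs a factor [2 * rho] in the constant and nothing in the radius. Repeated nodes
    need no separate treatment, and [M] is unrelated to the nodes. *)
Lemma newton_interpolation L rho ms F c : 0 < rho -> separated L rho ->
  {in ms, forall mu, in_discs L rho mu} -> 0 <= c ->
  {in L, forall l, exists a, has_pseries F l c rho a} ->
  exists p G, [/\ {in L, forall l, exists a, has_pseries G l (c * (2 * rho) ^+ size ms) rho a},
    forall z, F z = p.[z] + \prod_(mu <- ms) (z - mu) * G z &
    forall n (M : 'M[C]_n.+1) B, nm M <= B -> {in ms, forall mu, normc mu <= B} ->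
      nm (horner_mx M p) <= newton_bound rho n.+1 B (size ms) c].
Proof.
move=> rho0 sepL; elim: ms F c => [|mu ms IHms] F c msL c0 FL.
  exists 0, F; split=> [l Ll|z|n M B _ _] /=.
  - by rewrite expr0 mulr1; apply: FL.
  - by rewrite horner0 big_nil add0r mul1r.
  - by rewrite rmorph0 nm0.
have mul : in_discs L rho mu by apply: msL; rewrite mem_head.
have [G1 [G1L G1E]] := divided_difference rho0 sepL FL mul.
have [||p [G [GL GE pB]]] := IHms G1 (2 * c * rho) _ _ G1L.
- by move=> nu ms_nu; apply: msL; rewrite in_cons ms_nu orbT.
- by rewrite !mulr_ge0 // ltW.
have Fmu : normc (F mu) <= 2 * c.
  by have [l Ll lmu] := mul; have [a Ha] := FL _ Ll; apply: has_pseries_bound Ha lmu.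
exists ((F mu)%:P + ('X - mu%:P) * p), G; split=> [l Ll|z|n M B MB msB] /=.
- have [a Ha] := GL l Ll; exists a; move: Ha.
  by rewrite exprS (_ : c * _ = 2 * c * rho * (2 * rho) ^+ size ms) //; ring.
- by rewrite G1E GE big_cons !hornerE; ring.
have B0 : 0 <= B := le_trans (nm_ge0 M) MB.
have muB : normc mu <= B by apply: msB; rewrite mem_head.
rewrite rmorphD rmorphM rmorphB /= horner_mx_X !horner_mx_C.
apply: le_trans (ler_nmD _ _) _; rewrite nm_scalar_mx; apply: lerD; first by rewrite ler_wpM2l.
apply: le_trans (ler_nmM _ _) _; apply: ler_pM; rewrite ?nm_ge0 //.
  by apply: le_trans (ler_nmB _ _) _; rewrite nm_scalar_mx lerD // ler_wpM2l.
by apply: pB => // nu ms_nu; apply: msB; rewrite in_cons ms_nu orbT.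
Qed.

(** The requirements on [rho] persist when [rho] grows, so finitely many of them can be met at
    once. *)
Lemma eventually_all (T : eqType) (s : seq T) (P : T -> R -> Prop) :
  {in s, forall x, exists rho0, forall rho, rho0 <= rho -> P x rho} ->
  exists rho0, forall rho, rho0 <= rho -> {in s, forall x, P x rho}.
Proof.
elim: s => [|x s IHs] H; first by exists 0 => rho _ x.
have [r1 H1] := H x (mem_head _ _).
have [|r2 H2] := IHs; first by move=> y ys; apply: H; rewrite in_cons ys orbT.
exists (Num.max r1 r2) => rho; rewrite ge_max => /andP[h1 h2] y.
by rewrite in_cons => /predU1P[->|ys]; [apply: H1 | apply: H2].
Qed.

Lemma normc_prod_ge r del z : 0 <= del -> {in r, forall l, del <= normc (z - l)} ->
  del ^+ size r <= normc (\prod_(l <- r) (z - l)).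
Proof.
move=> del0; elim: r => [|l r IHr] H; first by rewrite big_nil expr0 Normc.normc1.
rewrite big_cons exprS Normc.normcM ler_pM ?exprn_ge0 //; first by rewrite H // mem_head.
by apply: IHr => x xr; apply: H; rewrite in_cons xr orbT.
Qed.

Lemma horner_prod_XsubC r z : (\prod_(l <- r) ('X - l%:P)).[z] = \prod_(l <- r) (z - l).
Proof. by rewrite horner_prod; apply: eq_bigr => l _; rewrite hornerXsubC. Qed.

Lemma analytic_radius f (Omega : set C) r : open Omega -> analytic_on f Omega ->
  {in r, forall l, Omega l} -> exists rho, [/\ 0 < rho, separated r rho,
    {in r, forall l, exists a, has_pseries f l rho rho a} &
    {in r, forall l z, rho * normc (z - l) <= 2^-1 -> Omega z}].
Proof.
move=> oO fO rO.
have [r1 H1] : exists rho0, forall rho, rho0 <= rho ->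
    {in r, forall l, exists a, has_pseries f l rho rho a}.
  apply: eventually_all => l /rO /(analytic_has_pseries fO) [c [rho [a [rho0 fa]]]].
  exists (Num.max c rho) => rho'; rewrite ge_max => /andP[cr rr]; exists a.
  by apply: has_pseries_le fa; rewrite // ltW.
have [r2 H2] : exists rho0, forall rho, rho0 <= rho -> {in r, forall l,
    0 < rho -> forall z, rho * normc (z - l) <= 2^-1 -> Omega z}.
  apply: eventually_all => l /rO Ol.
  have /nbhs_normcP[d d0 Hd] : nbhs l Omega by apply: open_nbhs_nbhs.
  exists d^-1 => rho dr rho0 z zl; apply: Hd.
  rewrite -(ltr_pM2l rho0); apply: le_lt_trans zl _.
  apply: lt_le_trans (_ : d^-1 * d <= _); last by rewrite ler_wpM2r // ltW.
  by rewrite mulVf ?lt0r_neq0 // invf_lt1 // ltr1n.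
have [r3 H3] : exists rho0, forall rho, rho0 <= rho -> {in r, forall l,
    {in r, forall l', l != l' -> 5 / 2 <= rho * normc (l - l')}}.
  apply: eventually_all => l rl; apply: eventually_all => l' rl'.
  have [->|ll'] := eqVneq l l'; first by exists 0.
  have n0 : 0 < normc (l - l') by rewrite lt_def normc_eq0 subr_eq0 ll' normc_ge0.
  by exists (5 / 2 / normc (l - l')) => rho; rewrite ler_pdivrMr.
pose rho := 1 + `|r1| + `|r2| + `|r3|.
have h : 0 <= `|r1| /\ 0 <= `|r2| /\ 0 <= `|r3| by [].
have [l1 [l2 l3]] : r1 <= `|r1| /\ r2 <= `|r2| /\ r3 <= `|r3| by rewrite !ler_norm.
have rho0 : 0 < rho by rewrite /rho; lra.
exists rho; split=> //; first by move=> l l' rl rl'; apply: H3; rewrite // /rho; lra.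
- by apply: H1; rewrite /rho; lra.
by move=> l rl z; apply: H2; rewrite // /rho; lra.
Qed.

Theorem matfun_polynomial_approx f (Omega : set C) r (k : nat) :
  open Omega -> analytic_on f Omega -> {in r, forall l, Omega l} ->
  let q := \prod_(l <- r) ('X - l%:P) in
  exists p, forall n B, exists eps K, [/\ 0 < eps, 0 <= K &
    forall M : 'M[C]_n.+1, nm M <= B -> nm (horner_mx M q) <= eps ->
      spectrum M `<=` Omega /\
      nm (matfun f M - horner_mx M p) <= K * nm (horner_mx M q) ^+ k].
Proof.
move=> oO fO rO q.
have [rho [rho0 sepr fr rhoO]] := analytic_radius oO fO rO.
have r0 : 0 <= rho by exact: ltW.
pose rk := flatten (nseq k r).
have rkE z : \prod_(l <- rk) (z - l) = q.[z] ^+ k.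
  rewrite horner_prod_XsubC /rk; elim: k {rk} => [|k IHk]; first by rewrite big_nil expr0.
  by rewrite /= big_cat IHk exprS.
have rkr : {in rk, forall l, in_discs r rho l}.
  move=> l; rewrite /rk; elim: k {rk rkE} => //= k IHk.
  rewrite mem_cat => /orP[lr|//]; exists l => //.
  by rewrite subrr Normc.normc0 mulr0 invr_ge0.
have [p [g [gr gE _]]] := newton_interpolation rho0 sepr rkr r0 fr.
set c := rho * _ in gr; have c0 : 0 <= c by rewrite mulr_ge0 ?exprn_ge0 ?mulr_ge0.
(* A point within [del] of an eigenvalue that is itself within [del] of a root [l] satisfies
   [rho * |z - l| <= 1/4 + 1/4], hence stays in the disc of [l]. *)
exists p => n B; pose del := (4 * rho)^-1; have del0 : 0 < del by rewrite invr_gt0 mulr_gt0.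
(* An eigenvalue at distance at least [del] from all roots would give [|q(mu)| >= del ^+ size r],
   above [eps]. *)
pose eps := del ^+ size r / 2; have eps0 : 0 < eps by rewrite divr_gt0 ?exprn_gt0.
exists eps, (n.+1%:R * newton_bound rho n.+1 `|B| n.+1 c); split=> //.
  by rewrite mulr_ge0 // newton_bound_ge0.
move=> M MB qM.
have near mu : eigenvalue M mu -> exists2 l, l \in r & normc (mu - l) < del.
  move=> Mmu; apply/hasP; apply: contraT => /hasPn H.
  have := normc_prod_ge (ltW del0) (fun l rl => etrans (leNgt _ _) (H l rl) : _ <= _).
  have := le_trans (eigenvalue_horner_le q Mmu) qM; rewrite horner_prod_XsubC => h1 h2.
  have := le_trans h2 h1; rewrite /eps; have := exprn_gt0 (size r) del0; lra.
have del2 z l : normc (z - l) < del -> rho * normc (z - l) <= 4^-1.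
  rewrite /del -[X in _ < X]mul1r ltr_pdivlMr ?mulr_gt0 // => h; lra.
have [ms chE] := closed_field_poly_normal (char_poly M).
move: chE; rewrite (monicP (char_poly_monic M)) scale1r => chE.
have size_ms : size ms = n.+1.
  by have := size_char_poly M; rewrite chE size_prod_XsubC => -[].
have ms_eig : {in ms, forall mu, eigenvalue M mu}.
  by move=> mu; rewrite eigenvalue_root_char chE root_prod_XsubC.
have ms_disc : {in ms, forall mu, in_discs r rho mu}.
  move=> mu /ms_eig /near[l rl /del2 h]; exists l => //; lra.
have [p2 [G [Gr GE p2B]]] := newton_interpolation rho0 sepr ms_disc c0 gr.
have MO : spectrum M `<=` Omega.
  by move=> mu /near[l rl /del2 h]; apply: (rhoO l) => //; lra.
split=> //.
(* The error of this polynomial is [q ^+ k * G * char_poly M] with [G] bounded near the eigenvalues;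
   hence [f(M) - p(M) = q(M) ^+ k p2(M)]. *)
have Hint : hermite_interpolant f M (p + q ^+ k * p2).
  apply: hermite_interpolant_near fO MO _ => mu /near[l rl lmu].
  have [K1 K10 HK1] := horner_bounded q (normc mu + del).
  set c2 := c * _ in Gr.
  exists del, (K1 ^+ k * (2 * c2)); split=> // z zmu.
  have -> : f z - (p + q ^+ k * p2).[z] = q.[z] ^+ k * G z * (char_poly M).[z].
    have chz : (char_poly M).[z] = \prod_(nu <- ms) (z - nu).
      by rewrite chE horner_prod_XsubC.
    rewrite gE rkE GE chz hornerD hornerM horner_exp; ring.
  rewrite Normc.normcM ler_wpM2r ?normc_ge0 // Normc.normcM normcX.
  apply: ler_pM; rewrite ?exprn_ge0 ?normc_ge0 //.
    rewrite lerXn2r ?nnegrE ?normc_ge0 // HK1 // -(subrK mu z) addrC.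
    by apply: le_trans (ler_normcD _ _) _; rewrite lerD2l ltW.
  have [a Ha] := Gr l rl; apply: has_pseries_bound Ha _.
  have : rho * normc (z - l) <= rho * (normc (z - mu) + normc (mu - l)).
    by rewrite ler_wpM2l // ler_normc_distD.
  by move: (del2 _ _ zmu) (del2 _ _ lmu); lra.
rewrite (matfun_interpolant Hint) rmorphD rmorphM rmorphXn /= addrAC subrr add0r.
apply: le_trans (ler_nmM _ _) _; rewrite mulrAC.
rewrite size_ms in p2B; apply: ler_pM; rewrite ?nm_ge0 ?ler_nm_expr //.
apply: p2B => [|mu /ms_eig Mmu]; first by rewrite (le_trans MB) // ler_norm.
have := eigenvalue_horner_le 'X Mmu; rewrite hornerX horner_mx_X => h.
by rewrite (le_trans h) // (le_trans MB) // ler_norm.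
Qed.

End MatrixFunctionPolynomial.

(** * Differentiation along coordinate lines *)

Section MatrixCurves.
Variable R : realType.
Local Notation C := R[i].
Implicit Types (m n p q : nat) (t eps K : R).

Lemma nbhs0_ltr (d : R) : 0 < d -> \forall t \near (0 : R), `|t| < d.
Proof.
move=> d0; apply/nbhs_ballP; exists d => // t.
by rewrite -ball_normE /= sub0r normrN.
Qed.

(** The little-o form suits products, blocks and perturbations; [pderiv1P] identifies it with
    partial derivatives taken on real and imaginary parts. *)
Definition has_deriv0 m n (M : R -> 'M[C]_(m, n)) (E : 'M[C]_(m, n)) :=
  forall eps, 0 < eps -> \forall t \near (0 : R),
    nm (M t - M 0 - t%:C%C *: E) <= eps * `|t|.

Lemma has_deriv0_lipschitz m n (M : R -> 'M[C]_(m, n)) E : has_deriv0 M E ->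
  \forall t \near (0 : R), nm (M t - M 0) <= (1 + nm E) * `|t|.
Proof.
move=> /(_ 1 ltr01); apply: filterS => t Ht.
rewrite -[M t - M 0](subrK (t%:C%C *: E)); apply: le_trans (ler_nmD _ _) _.
by rewrite nmZ normcR mulrDl [nm E * _]mulrC; apply: lerD.
Qed.

Lemma has_deriv0_near m n (M N : R -> 'M[C]_(m, n)) E : M 0 = N 0 ->
  (\forall t \near (0 : R), M t = N t) -> has_deriv0 M E -> has_deriv0 N E.
Proof.
move=> MN0 MN ME eps /ME; apply: filterS2 MN => t <-; by rewrite MN0.
Qed.

Lemma has_deriv0_quadratic m n (M N : R -> 'M[C]_(m, n)) E K : M 0 = N 0 ->
  (\forall t \near (0 : R), nm (N t - M t) <= K * `|t| ^+ 2) -> has_deriv0 M E -> has_deriv0 N E.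
Proof.
move=> MN0 MN ME eps eps0; have e20 : 0 < eps / 2 by rewrite divr_gt0.
have d0 : 0 < eps / 2 / (`|K| + 1) by rewrite divr_gt0 // ltr_wpDl.
have := nbhs0_ltr d0; apply: filterS3 MN (ME _ e20) => t h1 h2 h3.
have -> : N t - N 0 - t%:C%C *: E = (N t - M t) + (M t - M 0 - t%:C%C *: E).
  by rewrite MN0 !addrA subrK.
apply: le_trans (ler_nmD _ _) _; rewrite [eps]splitr mulrDl; apply: lerD => //.
apply: le_trans h1 _; rewrite expr2 mulrA ler_wpM2r //.
move: h3; rewrite ltr_pdivlMr ?ltr_wpDl // => h3.
have : K * `|t| <= `|K| * `|t| by rewrite ler_wpM2r // ler_norm.
have := normr_ge0 t; lra.
Qed.

Lemma has_deriv0_cst m n (M : 'M[C]_(m, n)) : has_deriv0 (fun=> M) 0.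
Proof.
move=> eps eps0; apply: filterE => t.
by rewrite subrr scaler0 subrr nm0 mulr_ge0 // ltW.
Qed.

Lemma has_deriv0_scaled m n p q (M : R -> 'M[C]_(m, n)) (N : R -> 'M[C]_(p, q)) E F K : 0 < K -> has_deriv0 M E ->
  (forall t, nm (N t - N 0 - t%:C%C *: F) <= K * nm (M t - M 0 - t%:C%C *: E)) ->
  has_deriv0 N F.
Proof.
move=> K0 ME H eps eps0; have e0 : 0 < eps / K by rewrite divr_gt0.
have := ME _ e0; apply: filterS => t h; apply: le_trans (H t) _.
by rewrite -ler_pdivlMl // mulrA [K^-1 * _]mulrC.
Qed.

Lemma has_deriv0_ursubmx m n p q (M : R -> 'M[C]_(m + p, n + q)) E : has_deriv0 M E ->
  has_deriv0 (fun t => ursubmx (M t)) (ursubmx E).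
Proof.
move=> ME; apply: (has_deriv0_scaled ltr01 ME) => t; rewrite mul1r.
have -> : ursubmx (M t) - ursubmx (M 0) - t%:C%C *: ursubmx E =
   ursubmx (M t - M 0 - t%:C%C *: E) by apply/matrixP => i j; rewrite !mxE.
exact: nm_ursubmx.
Qed.

Lemma has_deriv0D m n (M N : R -> 'M[C]_(m, n)) E F : has_deriv0 M E -> has_deriv0 N F ->
  has_deriv0 (fun t => M t + N t) (E + F).
Proof.
move=> ME NF eps eps0; have e20 : 0 < eps / 2 by rewrite divr_gt0.
apply: filterS2 (ME _ e20) (NF _ e20) => t h1 h2.
have -> : M t + N t - (M 0 + N 0) - t%:C%C *: (E + F) =
    (M t - M 0 - t%:C%C *: E) + (N t - N 0 - t%:C%C *: F).
  by rewrite scalerDr !opprD [in RHS]addrACA (addrACA (M t)).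
by apply: le_trans (ler_nmD _ _) _; rewrite [eps]splitr mulrDl; apply: lerD.
Qed.

Lemma has_deriv0M m n p (M : R -> 'M[C]_(m, n)) (N : R -> 'M[C]_(n, p)) E F :
  has_deriv0 M E -> has_deriv0 N F -> has_deriv0 (fun t => M t *m N t) (E *m N 0 + M 0 *m F).
Proof.
move=> ME NF.
(* [L] is the first order part of the product; what it omits, [(M t - M 0) *m (N t - N 0)], is
   quadratic in [t]. *)
pose L t := M t *m N 0 + M 0 *m N t - M 0 *m N 0.
have L0 : L 0 = M 0 *m N 0 by rewrite /L addrK.
apply: (@has_deriv0_quadratic _ _ L _ _ ((1 + nm E) * (1 + nm F))) => //.
  apply: filterS2 (has_deriv0_lipschitz ME) (has_deriv0_lipschitz NF) => t h1 h2.
  have -> : M t *m N t - L t = (M t - M 0) *m (N t - N 0).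
    rewrite /L mulmxBl !mulmxBr !opprD !opprK !addrA; congr (_ + _).
  apply: le_trans (ler_nmM _ _) _; rewrite expr2 mulrACA.
  by apply: ler_pM; rewrite ?nm_ge0.
move=> eps eps0; pose K := nm (N 0) + nm (M 0) + 1.
have K0 : 0 < K by rewrite ltr_wpDl // addr_ge0 ?nm_ge0.
have e0 : 0 < eps / K by rewrite divr_gt0.
apply: filterS2 (ME _ e0) (NF _ e0) => t h1 h2.
have -> : L t - L 0 - t%:C%C *: (E *m N 0 + M 0 *m F) =
   (M t - M 0 - t%:C%C *: E) *m N 0 + M 0 *m (N t - N 0 - t%:C%C *: F).
  rewrite L0 /L !mulmxBl !mulmxBr scalerDr scalemxAl scalemxAr opprD.
  rewrite [in RHS]addrACA; congr (_ + _); by rewrite [in RHS]addrACA addrA.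
apply: le_trans (ler_nmD _ _) _.
apply: le_trans (lerD (ler_nmM _ _) (ler_nmM _ _)) _.
apply: le_trans (_ : eps / K * `|t| * nm (N 0) + nm (M 0) * (eps / K * `|t|) <= _).
  by apply: lerD; [rewrite ler_wpM2r ?nm_ge0 | rewrite ler_wpM2l ?nm_ge0].
rewrite mulrC -mulrDl.
apply: le_trans (_ : K * (eps / K * `|t|) <= _); last first.
  by rewrite mulrA [K * _]mulrC divfK // lt0r_neq0.
by rewrite ler_wpM2r ?mulr_ge0 ?invr_ge0 ?(ltW eps0) ?(ltW K0) // /K lerDl.
Qed.

Lemma matrix_bound m n (M : 'M[C]_(m, n)) K : 0 <= K ->
  (forall i j, normc (M i j) <= K) -> nm M <= (m * n)%:R * K.
Proof.
move=> K0 MK; apply: le_trans (_ : \sum_(i < m) \sum_(j < n) K <= _).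
  by apply: ler_sum => i _; apply: ler_sum => j _; apply: MK.
by rewrite !sumr_const !card_ord -mulrnA mulr_natl mulnC.
Qed.

Lemma ler_entry_mx_norm m n (M : 'M[R]_(m, n)) i j : `|M i j| <= `|M|.
Proof.
rewrite [leRHS]mx_normrE.
exact: (le_bigmax _ (fun ij : 'I_m * 'I_n => `|M ij.1 ij.2|) (i, j)).
Qed.

Lemma mx_norm_le (T : numDomainType) m n (M : 'M[T]_(m, n)) (K : T) : 0 <= K ->
  (forall i j, `|M i j| <= K) -> `|M| <= K.
Proof.
move=> K0 MK; rewrite /Num.norm /=.
by have [->//|/mx_norm_neq0[[i j] ->]] := eqVneq (mx_norm M) 0.
Qed.

Lemma nm_le_ReIm m n (M : 'M[C]_(m, n)) :
  nm M <= (m * n)%:R * (`|map_mx (@complex.Re R) M| + `|map_mx (@complex.Im R) M|).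
Proof.
apply: matrix_bound => [|i j]; first by rewrite addr_ge0.
apply: le_trans (ler_normc_ReIm _) _; apply: lerD.
  by have := ler_entry_mx_norm (map_mx (@complex.Re R) M) i j; rewrite mxE.
by have := ler_entry_mx_norm (map_mx (@complex.Im R) M) i j; rewrite mxE.
Qed.

Lemma Re_le_nm m n (M : 'M[C]_(m, n)) : `|map_mx (@complex.Re R) M| <= nm M.
Proof.
apply: mx_norm_le => [|i j]; first exact: nm_ge0.
by rewrite mxE; apply: le_trans (ger_normc_Re _) _; apply: ler_normc_nm.
Qed.

Lemma Im_le_nm m n (M : 'M[C]_(m, n)) : `|map_mx (@complex.Im R) M| <= nm M.
Proof.
apply: mx_norm_le => [|i j]; first exact: nm_ge0.
by rewrite mxE; apply: le_trans (ger_normc_Im _) _; apply: ler_normc_nm.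
Qed.

End MatrixCurves.

Section PartialDerivativeCurves.
Variables (R : realType) (j : nat).
Local Notation C := R[i].
Implicit Types (x y : 'rV[R]_j) (i : 'I_j) (t eps : R).

Definition line i x (t : R) : 'rV[R]_j := t *: delta_mx 0 i + x.

Lemma line0 i x : line i x 0 = x.
Proof. by rewrite /line scale0r add0r. Qed.

Lemma cvg_line i x : line i x t @[t --> (0 : R)] --> x.
Proof.
rewrite -[X in _ --> X](line0 i); apply: cvgD; last exact: cvg_cst.
by apply: cvgZr_tmp.
Qed.

Lemma near_line i x (P : 'rV[R]_j -> Prop) : (\forall y \near x, P y) ->
  \forall t \near (0 : R), P (line i x t).
Proof. by move=> xP; have := @cvg_line i x _ xP. Qed.

Lemma is_derive_near m n (G : 'rV[R]_j -> 'M[R]_(m, n)) i x (L : 'M[R]_(m, n)) :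
  (derivable G x (delta_mx 0 i) /\ 'D_(delta_mx 0 i) G x = L) <->
  (forall eps, 0 < eps -> \forall t \near (0 : R),
     `|G (line i x t) - G x - t *: L| <= eps * `|t|).
Proof.
have E (t : R) : t != 0 -> t *: (L - t^-1 *: (G (line i x t) - G x)) =
    - (G (line i x t) - G x - t *: L).
  by move=> t0; rewrite scalerBr scalerA divff // scale1r [RHS]opprB.
split=> [[Gd GL] eps eps0|H].
  have : (fun h => h^-1 *: ((G \o shift x) (h *: delta_mx 0 i) - G x)) @ 0^' --> L.
    by rewrite -GL; apply: Gd.
  move=> /cvgrPdist_le /(_ _ eps0); rewrite near_withinE; apply: filterS => t Ht.
  have [->|t0] := eqVneq t 0; first by rewrite line0 scale0r subr0 subrr !normr0 mulr0.
  by rewrite -normrN -E // normrZ mulrC ler_wpM2r //; apply: Ht.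
have cv : (fun h => h^-1 *: ((G \o shift x) (h *: delta_mx 0 i) - G x)) @ 0^' --> L.
  apply/cvgrPdist_le => eps eps0; rewrite near_withinE.
  apply: filterS (H _ eps0) => t Ht t0.
  by rewrite -(ler_pM2l (_ : 0 < `|t|)) ?normr_gt0 // -normrZ E // normrN mulrC.
split; first by apply/cvg_ex; exists L.
by apply: cvg_lim cv; apply: norm_hausdorff.
Qed.

Lemma pderiv1P m n (F : 'rV[R]_j -> 'M[C]_(m, n)) i x E :
  (pderivable1 i F x /\ pderiv1 i F x = E) <-> has_deriv0 (fun t => F (line i x t)) E.
Proof.
pose ReE := map_mx (@complex.Re R) E; pose ImE := map_mx (@complex.Im R) E.
have ReF t : map_mx (@complex.Re R) (F (line i x t) - F x - t%:C%C *: E) =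
    Defs.ReM F (line i x t) - Defs.ReM F x - t *: ReE.
  apply/matrixP => a b; rewrite !mxE.
  case: (F _ _ _) (F _ _ _) (E _ _) => ? ? [? ?] [? ?] /=; by rewrite mul0r subr0.
have ImF t : map_mx (@complex.Im R) (F (line i x t) - F x - t%:C%C *: E) =
    Defs.ImM F (line i x t) - Defs.ImM F x - t *: ImE.
  apply/matrixP => a b; rewrite !mxE.
  case: (F _ _ _) (F _ _ _) (E _ _) => ? ? [? ?] [? ?] /=; by rewrite mul0r addr0.
split=> [[[dRe dIm] FE] eps eps0|H].
  have hRe := (is_derive_near (Defs.ReM F) i x ReE).1.
  have hIm := (is_derive_near (Defs.ImM F) i x ImE).1.
  have {}hRe : derivable (Defs.ReM F) x (delta_mx 0 i) /\ 'D_(delta_mx 0 i) (Defs.ReM F) x = ReE.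
    by split=> //; rewrite /ReE -FE; apply/matrixP => a b; rewrite !mxE.
  have {}hIm : derivable (Defs.ImM F) x (delta_mx 0 i) /\ 'D_(delta_mx 0 i) (Defs.ImM F) x = ImE.
    by split=> //; rewrite /ImE -FE; apply/matrixP => a b; rewrite !mxE.
  pose e := eps / ((m * n)%:R * 2 + 1).
  have e0 : 0 < e by rewrite divr_gt0 // ltr_wpDl // mulr_ge0.
  move/is_derive_near: hRe => /(_ e e0) hRe; move/is_derive_near: hIm => /(_ e e0).
  apply: filterS2 hRe => t h1 h2; rewrite line0.
  apply: le_trans (nm_le_ReIm _) _; rewrite ReF ImF.
  apply: le_trans (_ : (m * n)%:R * (e * `|t| + e * `|t|) <= _).
    by rewrite ler_wpM2l // lerD.
  have <- : ((m * n)%:R * 2 + 1) * e = eps.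
    by rewrite /e mulrC divfK // lt0r_neq0 // ltr_wpDl // mulr_ge0.
  have : 0 <= e * `|t| by rewrite mulr_ge0 // ltW.
  by set u := (m * n)%:R; set v := `|t|; lra.
have [dRe ERe] : derivable (Defs.ReM F) x (delta_mx 0 i) /\ 'D_(delta_mx 0 i) (Defs.ReM F) x = ReE.
  apply/is_derive_near => eps /H; apply: filterS => t; rewrite line0 => h.
  by apply: le_trans h; rewrite -ReF Re_le_nm.
have [dIm EIm] : derivable (Defs.ImM F) x (delta_mx 0 i) /\ 'D_(delta_mx 0 i) (Defs.ImM F) x = ImE.
  apply/is_derive_near => eps /H; apply: filterS => t; rewrite line0 => h.
  by apply: le_trans h; rewrite -ImF Im_le_nm.
split; first by [].
by apply/matrixP => a b; rewrite !mxE ERe EIm !mxE; case: (E a b).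
Qed.

Lemma differentiable_pderivable1 m n (F : 'rV[R]_j -> 'M[C]_(m, n)) i x :
  differentiable (Defs.ReM F) x -> differentiable (Defs.ImM F) x -> pderivable1 i F x.
Proof. by move=> dRe dIm; split; apply: diff_derivable. Qed.

Lemma twice_differentiable_near m n (F : 'rV[R]_j -> 'M[C]_(m, n)) i x :
  twice_differentiable F x -> \forall y \near x, pderivable1 i F y.
Proof.
move=> [[dRe _] [dIm _]]; apply: filterS2 dRe dIm => y.
exact: differentiable_pderivable1.
Qed.

(** Near [x] the differential applied to a basis vector is the partial derivative, and derivability
    is local. *)
Lemma twice_differentiable_pderivable1 m n (F : 'rV[R]_j -> 'M[C]_(m, n)) i1 i2 x :
  twice_differentiable F x -> pderivable1 i1 (pderiv1 i2 F) x.
Proof.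
move=> [[dRe d2Re] [dIm d2Im]]; pose v : 'rV[R]_j := delta_mx 0 i2.
have near_derivable (G H : 'rV[R]_j -> 'M[R]_(m, n)) w : differentiable G x ->
    (\forall y \near x, G y = H y) -> derivable H x w.
  move=> /diff_derivable Gd GH; exact: near_eq_derivable GH (Gd w).
split.
  apply: near_derivable (d2Re v) _; apply: filterS dRe => y dy.
  by rewrite -deriveE //; apply/matrixP => a b; rewrite !mxE.
apply: near_derivable (d2Im v) _; apply: filterS dIm => y dy.
by rewrite -deriveE //; apply/matrixP => a b; rewrite !mxE.
Qed.

Lemma twice_differentiable_continuous m n (F : 'rV[R]_j -> 'M[C]_(m, n)) x eps :
  twice_differentiable F x -> 0 < eps -> \forall y \near x, nm (F y - F x) <= eps.
Proof.
move=> [[dRe _] [dIm _]] eps0.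
have /differentiable_continuous cRe := nbhs_singleton dRe.
have /differentiable_continuous cIm := nbhs_singleton dIm.
pose e := eps / ((m * n)%:R * 2 + 1).
have e0 : 0 < e by rewrite divr_gt0 // ltr_wpDl // mulr_ge0.
move/cvgrPdist_le : cRe => /(_ e e0) hRe; move/cvgrPdist_le : cIm => /(_ e e0).
apply: filterS2 hRe => y h1 h2; apply: le_trans (nm_le_ReIm _) _.
apply: le_trans (_ : (m * n)%:R * (e + e) <= _).
  rewrite ler_wpM2l //; apply: lerD; rewrite map_mxB distrC.
    exact: h1.
  exact: h2.
have <- : ((m * n)%:R * 2 + 1) * e = eps.
  by rewrite /e mulrC divfK // lt0r_neq0 // ltr_wpDl // mulr_ge0.
by move: e0; set u := (m * n)%:R; lra.
Qed.

End PartialDerivativeCurves.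

(** * Block algebras and the complex step *)

Section BlockAlgebras.
Variable R : realType.
Local Notation C := R[i].
Implicit Types (n : nat) (p : {poly C}) (c : C).

(* Block models of [A + eps B] with [eps^2 = 0], and of [A + j B] with
   [j^2 = -1]; square block sizes are written as successors so that matrix
   polynomials apply. *)
Definition dual n (A B : 'M[C]_n.+1) : 'M[C]_((n + n.+1).+1) :=
  block_mx A B 0 A : 'M[C]_(n.+1 + n.+1).
Definition dual_part n (M : 'M[C]_((n + n.+1).+1)) : 'M[C]_n.+1 :=
  ursubmx (M : 'M[C]_(n.+1 + n.+1)).
Definition cplx n (A B : 'M[C]_n.+1) : 'M[C]_((n + n.+1).+1) :=
  block_mx A B (- B) A : 'M[C]_(n.+1 + n.+1).

Lemma dual_partE n (A B : 'M[C]_n.+1) : dual_part (dual A B) = B.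
Proof. exact: block_mxKur. Qed.

Lemma cplx_partE n (A B : 'M[C]_n.+1) : dual_part (cplx A B) = B.
Proof. exact: block_mxKur. Qed.

Lemma mul_dual n (A B A' B' : 'M[C]_n.+1) :
  dual A B *m dual A' B' = dual (A *m A') (A *m B' + B *m A').
Proof.
rewrite /dual (mulmx_block A B 0 A A' B' 0 A').
by rewrite !mulmx0 !mul0mx !addr0 !add0r.
Qed.

Lemma add_dual n (A B A' B' : 'M[C]_n.+1) : dual A B + dual A' B' = dual (A + A') (B + B').
Proof. by rewrite /dual (add_block_mx A B 0 A A' B' 0 A') addr0. Qed.

Lemma scalar_dual n c : c%:M = dual (c%:M : 'M[C]_n.+1) 0.
Proof. exact: (scalar_mx_block n.+1 n.+1). Qed.

Lemma mul_cplx n (A B A' B' : 'M[C]_n.+1) :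
  cplx A B *m cplx A' B' = cplx (A *m A' - B *m B') (A *m B' + B *m A').
Proof.
rewrite /cplx (mulmx_block A B (- B) A A' B' (- B') A').
by rewrite !mulNmx !mulmxN opprD [- (A *m B') - _]addrC [- (B *m B') + _]addrC.
Qed.

Lemma add_cplx n (A B A' B' : 'M[C]_n.+1) : cplx A B + cplx A' B' = cplx (A + A') (B + B').
Proof. by rewrite /cplx (add_block_mx A B (- B) A A' B' (- B') A') opprD. Qed.

Lemma opp_cplx n (A B : 'M[C]_n.+1) : - cplx A B = cplx (- A) (- B).
Proof. by rewrite /cplx (opp_block_mx A B (- B) A). Qed.

Lemma cplx0 n : cplx (0 : 'M[C]_n.+1) 0 = 0.
Proof. by rewrite /cplx oppr0; exact: (@block_mx0 C n.+1 n.+1 n.+1 n.+1). Qed.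

Lemma scalar_cplx n c : c%:M = cplx (c%:M : 'M[C]_n.+1) 0.
Proof. by rewrite /cplx oppr0; exact: (scalar_mx_block n.+1 n.+1). Qed.

(* The derivative of [p] at [A] in the direction [B]. *)
Definition dpoly p n (A B : 'M[C]_n.+1) := dual_part (horner_mx (dual A B) p).

Lemma horner_dual p n (A B : 'M[C]_n.+1) :
  horner_mx (dual A B) p = dual (horner_mx A p) (dpoly p A B).
Proof.
suff [Z pZ] : exists Z, horner_mx (dual A B) p = dual (horner_mx A p) Z.
  by rewrite /dpoly pZ dual_partE.
elim/poly_ind: p => [|p c [Z IHp]].
  exists 0; rewrite !rmorph0; have := scalar_dual n 0.
  by rewrite !raddf0.
exists (horner_mx A p *m B + Z *m A).
by rewrite !horner_mx_MXaddC IHp mul_dual scalar_dual add_dual addr0.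
Qed.

Lemma dpoly0 n (A B : 'M[C]_n.+1) : dpoly 0 A B = 0.
Proof. by rewrite /dpoly rmorph0 /dual_part; apply/matrixP => i j; rewrite !mxE. Qed.

Lemma dpoly_MXaddC p c n (A B : 'M[C]_n.+1) :
  dpoly (p * 'X + c%:P) A B = horner_mx A p *m B + dpoly p A B *m A.
Proof.
by rewrite {1}/dpoly horner_mx_MXaddC horner_dual mul_dual scalar_dual add_dual addr0 dual_partE.
Qed.

(* The mixed second derivative at [A] in the directions [B] and [G], plus the
   first derivative in the direction [D]. *)
Definition d2poly p n (A B G D : 'M[C]_n.+1) := dual_part (dpoly p (dual A B) (dual G D)).

Lemma dpoly_dual p n (A B G D : 'M[C]_n.+1) :
  dpoly p (dual A B) (dual G D) = dual (dpoly p A G) (d2poly p A B G D).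
Proof.
suff [Z pZ] : exists Z, dpoly p (dual A B) (dual G D) = dual (dpoly p A G) Z.
  by rewrite /d2poly pZ dual_partE.
elim/poly_ind: p => [|p c [Z IHp]].
  exists 0; rewrite !dpoly0; have := scalar_dual n 0.
  by rewrite !raddf0.
exists (horner_mx A p *m D + dpoly p A B *m G + (dpoly p A G *m B + Z *m A)).
by rewrite !dpoly_MXaddC IHp horner_dual !mul_dual add_dual.
Qed.

Lemma d2poly0 n (A B G D : 'M[C]_n.+1) : d2poly 0 A B G D = 0.
Proof. by rewrite /d2poly dpoly0; apply/matrixP => i j; rewrite !mxE. Qed.

Lemma d2poly_MXaddC p c n (A B G D : 'M[C]_n.+1) :
  d2poly (p * 'X + c%:P) A B G D =
  horner_mx A p *m D + dpoly p A B *m G + dpoly p A G *m B + d2poly p A B G D *m A.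
Proof.
by rewrite {1}/d2poly dpoly_MXaddC dpoly_dual horner_dual !mul_dual add_dual dual_partE addrA.
Qed.

(** This symmetry stands in for the symmetry of mixed derivatives: [alpha] fixes an order of
    differentiation that need not be that of [beta], [gamma]. *)
Lemma d2polyC p n (A B G D : 'M[C]_n.+1) : d2poly p A B G D = d2poly p A G B D.
Proof.
elim/poly_ind: p => [|p c IHp]; first by rewrite !d2poly0.
by rewrite !d2poly_MXaddC IHp; congr (_ + _); rewrite addrAC.
Qed.

Lemma has_deriv0_horner n (M : R -> 'M[C]_n.+1) E p : has_deriv0 M E ->
  has_deriv0 (fun t => horner_mx (M t) p) (dpoly p (M 0) E).
Proof.
move=> ME; elim/poly_ind: p => [|p c IHp].
  rewrite dpoly0; apply: (has_deriv0_near _ _ (has_deriv0_cst 0)); first by rewrite rmorph0.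
  by apply: filterE => t; rewrite rmorph0.
have := has_deriv0D (has_deriv0M IHp ME) (has_deriv0_cst (c%:M : 'M[C]_n.+1)).
rewrite addr0 dpoly_MXaddC [X in has_deriv0 _ X -> _]addrC; apply: has_deriv0_near.
  by rewrite horner_mx_MXaddC.
by apply: filterE => t; rewrite horner_mx_MXaddC.
Qed.

Lemma nm_dual n (A B : 'M[C]_n.+1) : nm (dual A B) = 2 * nm A + nm B.
Proof. by rewrite /dual (nm_block_mx A B 0 A) nm0; ring. Qed.

Lemma nm_cplx n (A B : 'M[C]_n.+1) : nm (cplx A B) = 2 * nm A + 2 * nm B.
Proof. by rewrite /cplx (nm_block_mx A B (- B) A) nmN; ring. Qed.

Lemma nm_dual_part n (M : 'M[C]_((n + n.+1).+1)) : nm (dual_part M) <= nm M.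
Proof. exact: (@nm_ursubmx R n.+1 n.+1 n.+1 n.+1 M). Qed.

Lemma has_deriv0_dual_part n (M : R -> 'M[C]_((n + n.+1).+1)) E : has_deriv0 M E ->
  has_deriv0 (fun t => dual_part (M t)) (dual_part E).
Proof. exact: (@has_deriv0_ursubmx R n.+1 n.+1 n.+1 n.+1 M). Qed.

Lemma has_deriv0_dual n (M N : R -> 'M[C]_n.+1) E F : has_deriv0 M E -> has_deriv0 N F ->
  has_deriv0 (fun t => dual (M t) (N t)) (dual E F).
Proof.
move=> ME NF eps eps0; have e0 : 0 < eps / 3 by rewrite divr_gt0.
apply: filterS2 (ME _ e0) (NF _ e0) => t h1 h2.
have -> : dual (M t) (N t) - dual (M 0) (N 0) - t%:C%C *: dual E F =
    dual (M t - M 0 - t%:C%C *: E) (N t - N 0 - t%:C%C *: F).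
  rewrite /dual (opp_block_mx (M 0) (N 0) 0 (M 0)) (scale_block_mx _ E F 0 E).
  rewrite (opp_block_mx (_ *: E) (_ *: F)) (add_block_mx (M t) (N t) 0 (M t)).
  by rewrite (add_block_mx (M t - M 0)) scaler0 !oppr0 !addr0.
by rewrite nm_dual; move: h1 h2; lra.
Qed.

End BlockAlgebras.

(** * Expansion of a polynomial at the block matrix *)

Section BlockComplexStep.
Variable R : realType.
Local Notation C := R[i].
Implicit Types (p : {poly C}) (k l : nat) (h K : R).

(** The fixed range [|h| <= 1] lets the estimates compose without neighbourhoods. *)
Definition bounded_by_expr k m n (F : R -> 'M[C]_(m, n)) :=
  exists K, forall h, `|h| <= 1 -> nm (F h) <= K * `|h| ^+ k.

Lemma bounded_by_expr_ge0 k m n (F : R -> 'M[C]_(m, n)) : bounded_by_expr k F ->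
  exists2 K, 0 <= K & forall h, `|h| <= 1 -> nm (F h) <= K * `|h| ^+ k.
Proof.
move=> [K HK]; exists `|K| => // h h1; apply: le_trans (HK h h1) _.
by rewrite ler_wpM2r ?exprn_ge0 // ler_norm.
Qed.

Lemma bounded_by_exprD k m n (F G : R -> 'M[C]_(m, n)) :
  bounded_by_expr k F -> bounded_by_expr k G -> bounded_by_expr k (fun h => F h + G h).
Proof.
move=> [K HK] [L HL]; exists (K + L) => h h1.
by apply: le_trans (ler_nmD _ _) _; rewrite mulrDl lerD ?HK ?HL.
Qed.

Lemma bounded_by_exprN k m n (F : R -> 'M[C]_(m, n)) :
  bounded_by_expr k F -> bounded_by_expr k (fun h => - F h).
Proof. by move=> [K HK]; exists K => h h1; rewrite nmN HK. Qed.

Lemma bounded_by_exprMr k m n q (F : R -> 'M[C]_(m, n)) (M : 'M[C]_(n, q)) :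
  bounded_by_expr k F -> bounded_by_expr k (fun h => F h *m M).
Proof.
move=> [K HK]; exists (K * nm M) => h h1; apply: le_trans (ler_nmM _ _) _.
by rewrite mulrAC ler_wpM2r ?nm_ge0 ?HK.
Qed.

Lemma bounded_by_exprZ k l m n (F : R -> 'M[C]_(m, n)) :
  bounded_by_expr k F -> bounded_by_expr (k + l) (fun h => h%:C%C ^+ l *: F h).
Proof.
move=> [K HK]; exists K => h h1.
by rewrite nmZ normcX normcR mulrC exprD mulrA ler_wpM2r ?exprn_ge0 ?HK.
Qed.

Lemma bounded_by_expr_le k l m n (F : R -> 'M[C]_(m, n)) : (l <= k)%N ->
  bounded_by_expr k F -> bounded_by_expr l F.
Proof.
move=> lk /bounded_by_expr_ge0[K K0 HK]; exists K => h h1.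
by apply: le_trans (HK h h1) _; rewrite ler_wpM2l // ler_wiXn2l.
Qed.

Lemma bounded_by_expr_cst m n (M : 'M[C]_(m, n)) : bounded_by_expr 0 (fun=> M).
Proof. by exists (nm M) => h _; rewrite expr0 mulr1. Qed.

Lemma bounded_by_expr_eq k m n (F G : R -> 'M[C]_(m, n)) : F =1 G ->
  bounded_by_expr k F -> bounded_by_expr k G.
Proof. by move=> FG [K HK]; exists K => h /HK; rewrite FG. Qed.

(** This reads [A + i1 h B + i2 h G + i1 i2 h^2 D], with [i1] the inner and [i2] the outer unit; the
    (1,4) block is the coefficient of [i1 i2]. *)
Lemma block_complex_stepE n (A B G D : 'M[C]_n.+1) (h : C) :
  block_complex_step A B G D h = cplx (cplx A (h *: B)) (cplx (h *: G) (h ^+ 2 *: D)).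
Proof.
by rewrite /block_complex_step {1}/cplx opp_cplx /cplx opprK.
Qed.

Lemma block14_cplx n (P Q S T : 'M[C]_n.+1) : block14 (cplx (cplx P Q) (cplx S T)) = T.
Proof.
rewrite -[RHS](cplx_partE S) -[in RHS](cplx_partE (cplx P Q) (cplx S T)).
by [].
Qed.

(** With units of square 0 the subtracted terms would be exact. Each square -1 adds terms smaller by
    [h^2], and the orders 2, 3, 3, 4 are preserved by multiplication by the block matrix. *)
Lemma horner_block_complex_step n (A B G D : 'M[C]_n.+1) p :
  exists P Q S T : R -> 'M[C]_n.+1,
  [/\ forall h, horner_mx (block_complex_step A B G D h%:C%C) p =
        cplx (cplx (P h) (Q h)) (cplx (S h) (T h)),
      bounded_by_expr 2 (fun h => P h - horner_mx A p),
      bounded_by_expr 3 (fun h => Q h - h%:C%C *: dpoly p A B),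
      bounded_by_expr 3 (fun h => S h - h%:C%C *: dpoly p A G) &
      bounded_by_expr 4 (fun h => T h - h%:C%C ^+ 2 *: d2poly p A B G D)].
Proof.
(* The regroupings of remainders are purely additive, hence checked entrywise, where [ring]
   applies. *)
have sub4 (a b c d a' b' c' d' : 'M[C]_n.+1) : a + b + c + d - (a' + b' + c' + d') =
    (a - a') + (b - b') + (c - c') + (d - d').
  by apply/matrixP => i k; rewrite !mxE; ring.
have id1 (a b s t e q : 'M[C]_n.+1) : a - q - b - s + t = a - b - (s - t) + e - (q + e).
  by apply/matrixP => i k; rewrite !mxE; ring.
have id2 (a b s t e q : 'M[C]_n.+1) : (a - e) + (b - q) - s - t = a + b - (s + t) - (e + q).
  by apply/matrixP => i k; rewrite !mxE; ring.
have id3 (a b s t e q : 'M[C]_n.+1) : (a - e) + (b - q) - s - t = (a - s) + (b - t) - (e + q).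
  by apply/matrixP => i k; rewrite !mxE; ring.
have id4 (z : C) (P P' Q Q' S S' T T' : 'M[C]_n.+1) :
    z ^+ 2 *: ((P - P') *m D) + z ^+ 1 *: ((Q - z *: Q') *m G)
      + z ^+ 1 *: ((S - z *: S') *m B) + (T - z ^+ 2 *: T') *m A =
    (z ^+ 2 *: (P *m D) + z *: (Q *m G)) + (z *: (S *m B) + T *m A)
      - z ^+ 2 *: (P' *m D + Q' *m G + S' *m B + T' *m A).
  rewrite expr1 expr2 !mulmxBl -!scalemxAl !scalerBr !scalerA.
  by rewrite -sub4 !scalerDr addrA.
have bnd k F (M : 'M[C]_n.+1) : bounded_by_expr k.+1 (fun h => F h - h%:C%C ^+ k *: M) ->
    bounded_by_expr k F.
  move=> /(bounded_by_expr_le (leqnSn k)) Fk.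
  apply: bounded_by_expr_eq (bounded_by_exprD Fk (bounded_by_exprZ k (bounded_by_expr_cst M))).
  by move=> h; rewrite subrK.
elim/poly_ind: p => [|p c [P [Q [S [T [XE P2 Q3 S3 T4]]]]]].
  have z k : bounded_by_expr k (fun=> 0 : 'M[C]_n.+1).
    by exists 0 => h _; rewrite nm0 mul0r.
  exists (fun=> 0), (fun=> 0), (fun=> 0), (fun=> 0); split.
  - by move=> h; rewrite rmorph0 !cplx0.
  - by apply: bounded_by_expr_eq (z 2) => h; rewrite rmorph0 subrr.
  - by apply: bounded_by_expr_eq (z 3) => h; rewrite dpoly0 scaler0 subrr.
  - by apply: bounded_by_expr_eq (z 3) => h; rewrite dpoly0 scaler0 subrr.
  - by apply: bounded_by_expr_eq (z 4) => h; rewrite d2poly0 scaler0 subrr.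
(* The coefficients' own orders suffice for the products in which a unit meets itself. *)
have Q1 : bounded_by_expr 1 Q by apply: bnd (bounded_by_expr_le (isT : 2 <= 3)%N Q3).
have S1 : bounded_by_expr 1 S by apply: bnd (bounded_by_expr_le (isT : 2 <= 3)%N S3).
have T2 : bounded_by_expr 2 T by apply: bnd (bounded_by_expr_le (isT : 3 <= 4)%N T4).
exists (fun h => (P h *m A - h%:C%C *: (Q h *m B)) -
    (h%:C%C *: (S h *m G) - h%:C%C ^+ 2 *: (T h *m D)) + c%:M).
exists (fun h => (h%:C%C *: (P h *m B) + Q h *m A) -
    (h%:C%C ^+ 2 *: (S h *m D) + h%:C%C *: (T h *m G))).
exists (fun h => (h%:C%C *: (P h *m G) - h%:C%C ^+ 2 *: (Q h *m D)) +
    (S h *m A - h%:C%C *: (T h *m B))).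
exists (fun h => (h%:C%C ^+ 2 *: (P h *m D) + h%:C%C *: (Q h *m G)) +
    (h%:C%C *: (S h *m B) + T h *m A)).
split.
- move=> h; rewrite horner_mx_MXaddC XE block_complex_stepE !mul_cplx opp_cplx !add_cplx.
  rewrite -!scalemxAr.
  have -> : c%:M = cplx (cplx (c%:M : 'M[C]_n.+1) 0) (cplx 0 0).
    by rewrite cplx0 -!scalar_cplx.
  by rewrite !add_cplx !addr0.
- apply: bounded_by_expr_eq (bounded_by_exprD (bounded_by_exprD
    (bounded_by_exprD (bounded_by_exprMr A P2)
      (bounded_by_exprN (bounded_by_exprZ 1 (bounded_by_exprMr B Q1))))
      (bounded_by_exprN (bounded_by_exprZ 1 (bounded_by_exprMr G S1))))
      (bounded_by_expr_le (isT : 2 <= 4)%N (bounded_by_exprZ 2 (bounded_by_exprMr D T2)))).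
  by move=> h; rewrite horner_mx_MXaddC !expr1 mulmxBl; apply: id1.
- apply: bounded_by_expr_eq (bounded_by_exprD (bounded_by_exprD
    (bounded_by_exprD (bounded_by_exprZ 1 (bounded_by_exprMr B P2)) (bounded_by_exprMr A Q3))
      (bounded_by_exprN (bounded_by_exprZ 2 (bounded_by_exprMr D S1))))
      (bounded_by_exprN (bounded_by_exprZ 1 (bounded_by_exprMr G T2)))).
  move=> h; rewrite dpoly_MXaddC !mulmxBl !scalerBr -!scalemxAl !expr1 scalerDr.
  exact: id2.
- apply: bounded_by_expr_eq (bounded_by_exprD (bounded_by_exprD
    (bounded_by_exprD (bounded_by_exprZ 1 (bounded_by_exprMr G P2)) (bounded_by_exprMr A S3))
      (bounded_by_exprN (bounded_by_exprZ 2 (bounded_by_exprMr D Q1))))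
      (bounded_by_exprN (bounded_by_exprZ 1 (bounded_by_exprMr B T2)))).
  move=> h; rewrite dpoly_MXaddC !mulmxBl !scalerBr -!scalemxAl !expr1 scalerDr.
  exact: id3.
apply: bounded_by_expr_eq (bounded_by_exprD (bounded_by_exprD
    (bounded_by_exprD (bounded_by_exprZ 2 (bounded_by_exprMr D P2))
      (bounded_by_exprZ 1 (bounded_by_exprMr G Q3)))
      (bounded_by_exprZ 1 (bounded_by_exprMr B S3)))
      (bounded_by_exprMr A T4)).
by move=> h; rewrite d2poly_MXaddC; apply: id4.
Qed.

End BlockComplexStep.

(** * Derivatives of matrix functions *)

Section MatrixFunctionDerivative.
Variable R : realType.
Local Notation C := R[i].
Implicit Types (f : C -> C) (Omega : set C) (p : {poly C}) (K t : R).

(* The characteristic polynomial is squared so that [dual A B] is a root. *)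
Definition curve_approximant f Omega n (A : 'M[C]_n.+1) p :=
  forall N (M : R -> 'M[C]_N.+1) K,
    (\forall t \near (0 : R), nm (M t - M 0) <= K * `|t|) ->
    horner_mx (M 0) (char_poly A ^+ 2) = 0 ->
    exists K', \forall t \near (0 : R), spectrum (M t) `<=` Omega /\
      nm (matfun f (M t) - horner_mx (M t) p) <= K' * `|t| ^+ 4.

(** Around a root [M0] of [q], of any size, [q(M)] is [O(M - M0)] by the Lipschitz bound, so its
    fourth power controls the error. *)
Lemma curve_approximant_exists f Omega n (A : 'M[C]_n.+1) :
  open Omega -> analytic_on f Omega -> spectrum A `<=` Omega ->
  (exists2 d : R, 0 < d & forall M, nm (M - A) <= d -> spectrum M `<=` Omega) /\
  exists p, curve_approximant f Omega A p.
Proof.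
move=> oO fO AO; have [s chE] := closed_field_poly_normal (char_poly A).
move: chE; rewrite (monicP (char_poly_monic A)) scale1r => chE.
have sO : {in s ++ s, forall l, Omega l}.
  move=> l; rewrite mem_cat orbb => sl; apply: AO.
  by rewrite /spectrum /= eigenvalue_root_char chE root_prod_XsubC.
(* Order 4 leaves [O(h^2)] after the division by [h^2]. *)
have [p Hp] := matfun_polynomial_approx 4 oO fO sO.
have qE : \prod_(l <- s ++ s) ('X - l%:P) = char_poly A ^+ 2 by rewrite big_cat -chE.
rewrite qE in Hp; set q := _ ^+ 2 in Hp.
suff near N (M0 : 'M[C]_N.+1) : horner_mx M0 q = 0 -> exists d K, [/\ 0 < d, 0 <= K &
    forall M, nm (M - M0) <= d -> spectrum M `<=` Omega /\
      nm (matfun f M - horner_mx M p) <= K * nm (M - M0) ^+ 4].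
  split.
    have [|d [K [d0 _ H]]] := near _ A; first by rewrite rmorphXn /= Cayley_Hamilton expr2 mul0r.
    by exists d; [exact: d0 | move=> M /H[MO _]; exact: MO].
  exists p => N M K ML M0; have [d [K' [d0 K'0 H]]] := near _ _ M0.
  exists (K' * `|K| ^+ 4).
  have e0 : 0 < d / (`|K| + 1) by rewrite divr_gt0 // ltr_wpDl.
  apply: filterS2 ML (nbhs0_ltr e0) => t h1 h2.
  have h3 : nm (M t - M 0) <= `|K| * `|t|.
    by apply: le_trans h1 _; rewrite ler_wpM2r // ler_norm.
  have [|MO h4] := H (M t).
    apply: le_trans h3 _; move: h2; rewrite ltr_pdivlMr ?ltr_wpDl // => h2.
    have := normr_ge0 t; lra.
  split=> //; apply: le_trans h4 _; rewrite -mulrA -exprMn ler_wpM2l //.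
  by rewrite lerXn2r // nnegrE ?nm_ge0 // mulr_ge0.
move=> M0q; pose B := nm M0 + 1.
have [L [L0 HL]] := horner_mx_lipschitz N q B.
have [eps [K [eps0 K0 H]]] := Hp N B.
exists (Num.min 1 (eps / (L + 1))), (K * L ^+ 4); split.
- by rewrite lt_min ltr01 divr_gt0 // ltr_wpDl.
- by rewrite mulr_ge0 ?exprn_ge0.
move=> M; rewrite le_min => /andP[h1 h2].
have MB : nm M <= B.
  rewrite -(subrK M0 M); apply: le_trans (ler_nmD _ _) _.
  by rewrite addrC lerD2l.
have M0B : nm M0 <= B by rewrite lerDl.
have [_] := HL _ _ MB M0B; rewrite M0q subr0 => qM.
have [|MO h3] := H M MB.
  apply: le_trans qM _; move: h2; rewrite ler_pdivlMr ?ltr_wpDl // => h2.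
  have := nm_ge0 (M - M0); lra.
split=> //; apply: le_trans h3 _; rewrite -mulrA -exprMn ler_wpM2l //.
by rewrite lerXn2r // nnegrE ?nm_ge0 // mulr_ge0 ?nm_ge0.
Qed.

(** On a constant curve the error bound at [t = 0] is zero. *)
Lemma curve_approximant_eq f Omega n (A : 'M[C]_n.+1) p N (M : 'M[C]_N.+1) :
  curve_approximant f Omega A p -> horner_mx M (char_poly A ^+ 2) = 0 ->
  matfun f M = horner_mx M p.
Proof.
move=> Ap Mq; have [|K' H] := Ap N (fun=> M) 0 _ Mq.
  by apply: filterE => t; rewrite subrr nm0 mul0r.
have [_] := nbhs_singleton H; rewrite normr0 expr0n mulr0 => h.
by apply/eqP; rewrite -subr_eq0; apply/eqP/nm_eq0/eqP; rewrite eq_le h nm_ge0.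
Qed.

(** By Cayley-Hamilton the value of [char_poly A] has zero diagonal blocks, so its square
    vanishes. *)
Lemma horner_dual_char_poly2 n (A B : 'M[C]_n.+1) :
  horner_mx (dual A B) (char_poly A ^+ 2) = 0.
Proof.
rewrite rmorphXn /= horner_dual Cayley_Hamilton expr2.
rewrite [_ * _](mul_dual 0 _ 0 _) !mul0mx mulmx0 addr0.
by have := scalar_dual n (0 : C); rewrite !raddf0.
Qed.

Lemma has_deriv0_matfun f Omega n (A : 'M[C]_n.+1) p N (M : R -> 'M[C]_N.+1) E :
  curve_approximant f Omega A p -> horner_mx (M 0) (char_poly A ^+ 2) = 0 ->
  has_deriv0 M E -> has_deriv0 (fun t => matfun f (M t)) (dpoly p (M 0) E).
Proof.
move=> Ap M0q ME; have [K' H] := Ap _ _ _ (has_deriv0_lipschitz ME) M0q.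
apply: (@has_deriv0_quadratic _ _ _ (fun t => horner_mx (M t) p) _ _ `|K'|).
- by rewrite (curve_approximant_eq Ap M0q).
- apply: filterS2 H (nbhs0_ltr ltr01) => t [_ h1] h2; apply: le_trans h1 _.
  apply: le_trans (_ : `|K'| * `|t| ^+ 4 <= _); first by rewrite ler_wpM2r ?exprn_ge0 // ler_norm.
  by rewrite ler_wpM2l // ler_wiXn2l // ltW.
exact: has_deriv0_horner.
Qed.

Variable j : nat.
Implicit Types (x y : 'rV[R]_j) (i : 'I_j).

(** The approximant depends on [y]. Written with [matfun] of a dual matrix, the derivative obeys one
    formula at all nearby points, which can be differentiated again. *)
Lemma pderiv1_matfun f Omega n (A : 'rV[R]_j -> 'M[C]_n.+1) i y :
  open Omega -> analytic_on f Omega -> spectrum (A y) `<=` Omega ->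
  pderivable1 i A y ->
  pderivable1 i (fun x => matfun f (A x)) y /\
  pderiv1 i (fun x => matfun f (A x)) y = dual_part (matfun f (dual (A y) (pderiv1 i A y))).
Proof.
move=> oO fO AO dA; have [_ [p Ap]] := curve_approximant_exists oO fO AO.
have /pderiv1P hA : pderivable1 i A y /\ pderiv1 i A y = pderiv1 i A y by [].
apply/pderiv1P; rewrite (curve_approximant_eq Ap) ?horner_dual_char_poly2 //.
have := has_deriv0_matfun Ap _ hA; rewrite line0; apply.
by rewrite rmorphXn /= Cayley_Hamilton expr2 mul0r.
Qed.

(** The dual matrices of the first derivative form a curve that starts at a root of
    [char_poly (A x) ^+ 2], so the approximant at [A x] also governs the second differentiation. *)
Lemma pderiv2_matfun f Omega n (A : 'rV[R]_j -> 'M[C]_n.+1) i1 i2 x p :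
  open Omega -> analytic_on f Omega -> spectrum (A x) `<=` Omega ->
  twice_differentiable A x -> curve_approximant f Omega (A x) p ->
  [/\ \forall y \near x, spectrum (A y) `<=` Omega,
    pderivable_seq [:: i1; i2] (fun x => matfun f (A x)) x &
    pderiv_seq [:: i1; i2] (fun x => matfun f (A x)) x =
    d2poly p (A x) (pderiv1 i2 A x) (pderiv1 i1 A x) (pderiv1 i1 (pderiv1 i2 A) x)].
Proof.
move=> oO fO AO dA Ap; have [[d d0 Hd] _] := curve_approximant_exists oO fO AO.
have nearO : \forall y \near x, spectrum (A y) `<=` Omega.
  by apply: filterS (twice_differentiable_continuous dA d0) => y /Hd.
have near1 : \forall y \near x, pderivable1 i2 (fun x => matfun f (A x)) y /\
    pderiv1 i2 (fun x => matfun f (A x)) y =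
    dual_part (matfun f (dual (A y) (pderiv1 i2 A y))).
  apply: filterS2 nearO (twice_differentiable_near i2 dA) => y.
  exact: pderiv1_matfun.
pose B t := dual (A (line i1 x t)) (pderiv1 i2 A (line i1 x t)).
have hB : has_deriv0 B (dual (pderiv1 i1 A x) (pderiv1 i1 (pderiv1 i2 A) x)).
  apply: has_deriv0_dual; apply/pderiv1P; split=> //.
    exact: nbhs_singleton (twice_differentiable_near i1 dA).
  exact: twice_differentiable_pderivable1.
have B0 : B 0 = dual (A x) (pderiv1 i2 A x) by rewrite /B line0.
have := has_deriv0_matfun Ap _ hB; rewrite B0 horner_dual_char_poly2 => /(_ erefl).
move=> /has_deriv0_dual_part; rewrite -/(d2poly _ _ _ _ _) => hfB.
have /pderiv1P[d2 d2E] : has_deriv0 (fun t => pderiv1 i2 (fun x => matfun f (A x)) (line i1 x t))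
    (d2poly p (A x) (pderiv1 i2 A x) (pderiv1 i1 A x) (pderiv1 i1 (pderiv1 i2 A) x)).
  apply: has_deriv0_near hfB.
    by rewrite B0 line0; have [_ ->] := nbhs_singleton near1.
  by apply: filterS (near_line i1 near1) => t [_ ->].
split=> //=; split=> //.
apply: filterS near1 => y [dy _]; split=> //.
exact: filterE.
Qed.

End MatrixFunctionDerivative.

(** * Multi-indices as words of coordinate indices *)

Section MultiIndices.
Variable j : nat.
Implicit Types (d e : multiindex j) (i : 'I_j).

Lemma count_multiindex_seq d i : count_mem i (multiindex_seq d) = d i.
Proof.
rewrite /multiindex_seq count_flatten -map_comp sumnE big_map big_enum /=.
rewrite (bigD1 i) //= count_nseq /= eqxx mul1n big1 ?addn0 // => k ki.
by rewrite count_nseq /= (negPf ki).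
Qed.

Lemma size_multiindex_seq d : size (multiindex_seq d) = multiindex_order d.
Proof.
rewrite /multiindex_seq size_flatten /shape -map_comp sumnE big_map big_enum /=.
by apply: eq_bigr => i _; rewrite size_nseq.
Qed.

Lemma multiindex_order1 d : multiindex_order d = 1%N -> exists i, multiindex_seq d = [:: i].
Proof. by rewrite -size_multiindex_seq; case: multiindex_seq => [|i []] //; exists i. Qed.

Lemma perm_multiindex_seqD d e :
  perm_eq (multiindex_seq (d + e)) (multiindex_seq d ++ multiindex_seq e).
Proof.
apply/allP => i _ /=; rewrite count_cat !count_multiindex_seq.
by rewrite ffunE.
Qed.

(** Words follow the enumeration of ['I_j], so the word of a sum is the concatenation only up to
    permutation. *)
Lemma multiindex_seq_pair d e a b : multiindex_seq d = [:: a] -> multiindex_seq e = [:: b] ->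
  multiindex_seq (d + e) = [:: a; b] \/ multiindex_seq (d + e) = [:: b; a].
Proof.
move=> da eb; have := perm_multiindex_seqD d e; rewrite da eb /=.
case: multiindex_seq => [|x [|y [|z s]]] h; try by have := perm_size h.
have : x \in [:: a; b] by rewrite -(perm_mem h) mem_head.
rewrite !inE => /orP[] /eqP xE; move: h; rewrite xE.
  by rewrite perm_cons => /perm_small_eq -> //; left.
rewrite (perm_sym _ [:: a; b]) -(perm_catC [:: b] [:: a]) /= perm_cons => h.
by rewrite (perm_small_eq _ h) //; right.
Qed.

End MultiIndices.

(** [matfun] and [pderiv] are total; the first three conclusions ensure that the terms of the last
    one have their intended meaning. *)
Theorem mainTheorem8 (R : realType) (n j : nat)
    (A : 'rV[R]_j -> 'M[R[i]]_n.+1) (xbar : 'rV[R]_j)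
    (Omega : set R[i]) (f : R[i] -> R[i])
    (alpha beta gamma : multiindex j)
    (X : R -> 'M[R[i]]_((quad_pred n).+1)) :
  twice_differentiable A xbar ->
  open Omega -> analytic_on f Omega -> spectrum (A xbar) `<=` Omega ->
  real_on_real_matrices f Omega ->
  multiindex_order beta = 1%N -> multiindex_order gamma = 1%N ->
  alpha = beta + gamma ->
  X = (fun h : R => block_complex_step (A xbar) (pderiv beta A xbar)
         (pderiv gamma A xbar) (pderiv alpha A xbar) h%:C%C) ->
  [/\ \forall x \near xbar, spectrum (A x) `<=` Omega,
      pderivable alpha (fun x => matfun f (A x)) xbar,
      \forall h \near (0 : R)^', spectrum (X h) `<=` Omega
    & (fun h : R => pderiv alpha (fun x => matfun f (A x)) xbar
                    - (h%:C%C ^+ 2)^-1 *: block14 (matfun f (X h)))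
      =O_ ((0 : R)^') (fun h : R => h%:C%C ^+ 2)].
Proof.
move=> dA oO fO AO _ /multiindex_order1[b betaE] /multiindex_order1[g gammaE] alphaE XE.
have [_ [p Ap]] := curve_approximant_exists oO fO AO.
set D := pderiv alpha A xbar in XE; set Ab := pderiv beta A xbar in XE.
set Ag := pderiv gamma A xbar in XE; set A0 := A xbar in XE.
have [nearO dfA dfE] : [/\ \forall x \near xbar, spectrum (A x) `<=` Omega,
    pderivable alpha (fun x => matfun f (A x)) xbar &
    pderiv alpha (fun x => matfun f (A x)) xbar = d2poly p A0 Ab Ag D].
  rewrite /D /Ab /Ag /pderivable /pderiv betaE gammaE alphaE.
  have [] := multiindex_seq_pair betaE gammaE => ->.
    have [h1 h2 h3] := pderiv2_matfun b g oO fO AO dA Ap.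
    split; [exact: h1|exact: h2|]; exact: (etrans h3 (d2polyC _ _ _ _ _)).
  have [h1 h2 h3] := pderiv2_matfun g b oO fO AO dA Ap.
  split; [exact: h1|exact: h2|exact: h3].
have [P [Q [S [T [pX _ _ _ [K4 HK4]]]]]] := horner_block_complex_step A0 Ab Ag D p.
have X0 : X 0 = cplx (cplx A0 0) 0.
  by rewrite XE block_complex_stepE !expr2 !mul0r !scale0r cplx0.
(* Each of the two nested [cplx] doubles the entrywise norm, hence the 4. *)
have Xlip : \forall h \near (0 : R), nm (X h - X 0) <=
    (4 * (nm Ab + nm Ag + nm D)) * `|h|.
  apply: filterS (nbhs0_ltr ltr01) => h /ltW h1.
  have -> : X h - X 0 = cplx (cplx 0 (h%:C%C *: Ab)) (cplx (h%:C%C *: Ag) (h%:C%C ^+ 2 *: D)).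
    rewrite X0 XE block_complex_stepE !opp_cplx !oppr0 add_cplx addr0.
    by rewrite add_cplx addr0 subrr.
  rewrite !nm_cplx nm0 !nmZ normcX !normcR.
  have : `|h| ^+ 2 * nm D <= `|h| * nm D.
    by rewrite ler_wpM2r ?nm_ge0 // expr2 ler_piMr.
  lra.
have X0q : horner_mx (X 0) (char_poly A0 ^+ 2) = 0.
  have horner_cplx m (M : 'M[R[i]]_m.+1) q : horner_mx (cplx M 0) q = cplx (horner_mx M q) 0.
    elim/poly_ind: q => [|q c IHq]; first by rewrite !rmorph0 cplx0.
    rewrite !horner_mx_MXaddC IHq mul_cplx scalar_cplx add_cplx.
    by rewrite !mulmx0 !mul0mx subr0 !addr0.
  rewrite X0 !horner_cplx rmorphXn /= Cayley_Hamilton.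
  by rewrite expr2 mul0r !cplx0.
have [K' HX] := Ap _ X _ Xlip X0q.
split=> //.
  by rewrite near_withinE; apply: filterS HX => h [].
(* [K'] comes from [f(X h) - p(X h)], [K4] from the expansion of [p(X h)], and 1 makes the constant
   positive. *)
rewrite dfE; apply/eqO_exP; pose K := `|K'| + `|K4| + 1.
have K0 : 0 < K by rewrite ltr_wpDl // addr_ge0.
exists K%:C%C; first by rewrite ltcR.
rewrite near_withinE; apply: filterS2 HX (nbhs0_ltr ltr01) => h [_ h1] /ltW h2 h0.
have nh : 0 < `|h| by rewrite normr_gt0.
rewrite [`|_ ^+ 2|]normr_normc normcX normcR.
apply: mx_norm_le => [|a b0]; first by rewrite -rmorphM lecR mulr_ge0 ?exprn_ge0 // ltW.
rewrite normr_normc -rmorphM lecR; apply: le_trans (ler_normc_nm _ _ _) _.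
have hC : h%:C%C != 0 :> R[i] by rewrite -normc_eq0 normcR gt_eqF.
set F := matfun f (X h).
have -> : d2poly p A0 Ab Ag D - (h%:C%C ^+ 2)^-1 *: block14 F =
   - ((h%:C%C ^+ 2)^-1 *: (block14 F - h%:C%C ^+ 2 *: d2poly p A0 Ab Ag D)).
  by rewrite scalerBr scalerA mulVf ?expf_neq0 // scale1r opprB.
rewrite nmN nmZ Normc.normcV normcX normcR ler_pdivrMl ?exprn_gt0 //.
have -> : block14 F - h%:C%C ^+ 2 *: d2poly p A0 Ab Ag D =
    block14 (F - horner_mx (X h) p) + (T h - h%:C%C ^+ 2 *: d2poly p A0 Ab Ag D).
  have -> : T h = block14 (horner_mx (X h) p) by rewrite XE pX block14_cplx.
  rewrite addrA; congr (_ - _).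
  by apply/matrixP => u v; rewrite !mxE subrK.
apply: le_trans (ler_nmD _ _) _.
have n14 (M : 'M[R[i]]_((quad_pred n).+1)) : nm (block14 M) <= nm M.
  exact: le_trans (nm_dual_part _) (nm_dual_part _).
have h3 := le_trans (n14 _) h1; have h4 := HK4 h h2.
have u0 : 0 <= `|h| ^+ 4 by rewrite exprn_ge0.
have k1 : K' * `|h| ^+ 4 <= `|K'| * `|h| ^+ 4 by rewrite ler_wpM2r // ler_norm.
have k2 : K4 * `|h| ^+ 4 <= `|K4| * `|h| ^+ 4 by rewrite ler_wpM2r // ler_norm.
rewrite mulrCA -exprD /K; move: h3 h4 k1 k2 u0; set u := `|h| ^+ 4; lra.
Qed.
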